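(* Let $p>3$ be prime, $q=p^s\equiv1\pmod N$, let $i,j,k$ be integers with $1\le i,j,k<N$, and let $\xi$ be a character of $\mathbb{F}_q^\times$ of order $N$. Then for $\lambda\in\mathbb{F}_q\setminus\{0,1\}$, \[ \#X_\lambda^{[N;i,j,k]}(\mathbb{F}_q)=1+q+q\sum_{m=1}^{N-1}\xi^{mj}(-1)\,{}_2F_1\!\left(\begin{matrix}\xi^{-km} & \xi^{im}\\ & \xi^{m(i+j)}\end{matrix};\lambda\right)+n_0+n_1+n_{1/\lambda}+n_\infty-4. \]
   Context: $X_\lambda^{[N;i,j,k]}$ is the smooth projective model (desingularization) over $\mathbb{F}_q$ of the curve $y^N=x^i(1-x)^j(1-\lambda x)^k$. For $P\in\{0,1,1/\lambda,\infty\}$, $n_P$ denotes the number of $\mathbb{F}_q$-rational points of $X_\lambda^{[N;i,j,k]}$ lying above $x=P$ (e.g. $n_0=\#\{w\in\mathbb{F}_q: w^{\gcd(N,i)}=1\}$). Characters are extended to $\mathbb{F}_q$ by $\chi(0)=0$; $\varepsilon$ is the trivial character, $\overline\chi$ the inverse. Greene's finite field hypergeometric function is \[ {}_2F_1\!\left(\begin{matrix}A & B\\ & C\end{matrix};\lambda\right)=\varepsilon(\lambda)\frac{BC(-1)}{q}\sum_{x\in\mathbb{F}_q}B(x)\,\overline{B}C(1-x)\,\overline{A}(1-\lambda x). \] *)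

(* Defs.v *)
From HB Require Import structures.
From mathcomp Require Import all_boot all_order all_algebra.
From mathcomp Require Import all_fingroup all_solvable all_field all_character.
From mathcomp Require Import finmap.
From mathcomp Require Import boolp classical_sets functions cardinality.

Set Implicit Arguments.
Unset Strict Implicit.
Unset Printing Implicit Defensive.

Import GRing.Theory Num.Theory.
Local Open Scope classical_set_scope.
Local Open Scope ring_scope.

(* The smooth projective model of a curve over a perfect field k is built from *)
(* its function fields, as in Hartshorne I.6 and Stichtenoth, ch. 1: its       *)
(* closed points are the pairs of an irreducible component of the curve and a  *)
(* valuation ring over k of the function field of this component; the          *)
(* residue field of the point is that of the valuation ring, so the            *)
(* k-rational points are the valuation rings with residue field k.             *)

Section ValuationRings.
Variables (k L : fieldType) (c : k -> L).
Implicit Type O : set L.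

(* Stichtenoth, Def. 1.1.4; valuation rings of a function field in one         *)
(* variable are automatically discrete.                                        *)
Definition valuation_ring O : Prop :=
  [/\ (forall x y, O x -> O y -> O (x - y)) /\
        (forall x y, O x -> O y -> O (x * y)),
      range c `<` O, O `<` setT
    & forall z, z != 0 -> O z \/ O z^-1].

Definition max_ideal O : set L :=
  [set z | O z /\ forall w, O w -> z * w <> 1].

(* The map from k to the residue field O / max_ideal O is onto. *)
Definition rational_place O : Prop :=
  valuation_ring O /\ forall z, O z -> exists a, max_ideal O (z - c a).

End ValuationRings.

Section Curve.
Variable F : fieldType.
Local Notation Fx := {fraction {poly F}}.
Local Notation tofrac := (@FracField.tofrac {poly F}).

(* The variable of {poly Fx} is y, that of {poly F} is x. As y ^ N - f(x) is   *)
(* monic in y, the irreducible components of this plane curve correspond, by   *)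
(* Gauss's lemma, to the monic irreducible factors g of curve_poly in Fx[y],   *)
(* and the function field of the component is Fx[y] / (g).                     *)
Definition curve_poly (N i j k : nat) (lam : F) : {poly Fx} :=
  'X^N - (tofrac ('X^i * (1 - 'X) ^+ j * (1 - lam *: 'X) ^+ k))%:P.

Definition const_fun (g : {poly Fx}) (a : F) : {poly %/ g} :=
  qpolyC g (tofrac a%:P).

(* A component of the curve, given by g, together with a subset of its         *)
(* function field.                                                             *)
Record point := Point { comp : {poly Fx}; ring_at : set {poly %/ comp} }.
Arguments ring_at : clear implicits.

(* The membership condition uses the field structure {poly %/ g with gI} on    *)
(* {poly %/ g}; the proof gI is not part of the point.                         *)
Definition rational_points (N i j k : nat) (lam : F) : set point :=
  [set P | comp P %| curve_poly N i j k lam /\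
     exists gI : monic_irreducible_poly (comp P),
       @rational_place F {poly %/ comp P with gI} (const_fun (comp P))
         (ring_at P)].

(* A uniformizer at P of the projective x-line, None being the point at        *)
(* infinity; a point of the model lies above x = P when this vanishes there.   *)
Definition x_param (P : option F) : Fx :=
  if P is Some a then tofrac ('X - a%:P) else (tofrac 'X)^-1.

Definition rational_points_above (N i j k : nat) (lam : F) (P : option F) :
    set point :=
  [set Q | rational_points N i j k lam Q /\
     exists gI : monic_irreducible_poly (comp Q),
       @max_ideal {poly %/ comp Q with gI} (ring_at Q)
         (qpolyC (comp Q) (x_param P))].

End Curve.
Arguments ring_at {F} _.

(* This is 0 if A is infinite. *)
Definition ncard (T : Type) (A : set T) : nat :=
  #|` fset_set (A : set {classic T})|%fset.

Section Characters.
Variable F : finFieldType.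
Local Notation mchar := 'CF([set: {unit F}]%G).

(* Extension by 0 at 0, also for the trivial character 1 : mchar. *)
Definition ext_char (chi : mchar) (x : F) : algC :=
  if insub x is Some u then chi (u : {unit F}) else 0.

(* For a linear character chi, chi^-1 in the ring mchar of class functions is  *)
(* the pointwise inverse.                                                      *)
Definition greene2F1 (A B C : mchar) (lam : F) : algC :=
  ext_char 1 lam * (ext_char (B * C) (-1) / #|F|%:R) *
  \sum_(x : F) ext_char B x * ext_char (B^-1 * C) (1 - x) *
               ext_char A^-1 (1 - lam * x).

End Characters.

(* Main.v *)
Require Import Defs.
From mathcomp Require Import all_boot all_order all_algebra.
From mathcomp Require Import all_fingroup all_solvable all_field all_character.
From mathcomp Require Import finmap.
From mathcomp Require Import boolp classical_sets functions cardinality.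
From mathcomp Require Import ring.
Import GRing.Theory Num.Theory.

(* The rational points are distributed over the rational points of the x-line.    *)
(* Above x = a with f(a) <> 0, where f = x^i (1 - x)^j (1 - lam x)^k, the curve   *)
(* y^N = f is smooth, so its local ring at (a, w), for w^N = f(a), is a           *)
(* valuation ring, and these are all the rational places above a. The number of   *)
(* these w is the sum of the xi(f(a))^m over 0 <= m < N, and summing over a turns *)
(* the nontrivial characters into hypergeometric values.                          *)
(* For the four remaining fibres only finiteness is needed: with q = #|F|, the    *)
(* function 1 / (z^q - z + 1) has residue 1 at the rational places where z is     *)
(* finite and 0 at the others; products of such functions, one for each place     *)
(* above a point, separate these places and so are independent over F(x).         *)

Set Implicit Arguments.
Unset Strict Implicit.
Unset Printing Implicit Defensive.
Local Open Scope classical_set_scope.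
Local Open Scope ring_scope.

(** * Residues at the places of a field *)

(** A rational place of the model restricts to exactly one rational point of the x-line, so the
    count splits into fibres ([rational_points_cover], [rational_points_disjoint]).

    Let f(a) <> 0. At a rational place above a, y takes a value w with w^N = f(a), and every such w
    comes from exactly one place ([ncard_unramified]). Indeed w is a simple root, so (a, w) lies on
    a single component ([irreducible_through], [irreducible_through_uniq]); its local ring there is
    a valuation ring with uniformizer x - a ([local_ring_rational], [eval_xy_principal]); and one
    rational place cannot properly contain another ([rational_place_sub]), so this ring is the only
    candidate.

    The number of w is a character sum ([card_power_roots]). The trivial character contributes 1 for
    each of the q - 3 values of a, and each nontrivial power of xi sums to a value of Greene's
    function ([greene2F1_sum]). The fibres over 0, 1, 1/lam and infinity enter the formula as
    unknown numbers; their finiteness ([finite_places]) comes from the finite degree of each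
    function field over F(x). *)

(** A relation rather than a function: z may have a pole at O, and for a general valuation ring the
    residue field may exceed k. *)
Definition residue (k L : fieldType) (c : k -> L) (O : set L) (z : L) (a : k) :=
  max_ideal O (z - c a).

Section Place.
Variables (k L : fieldType) (c : {rmorphism k -> L}) (O : set L).
Hypothesis OV : valuation_ring c O.
Local Notation res := (residue c O).

Lemma vringB x y : O x -> O y -> O (x - y).
Proof. by case: OV => -[h _] _ _ _; exact: h. Qed.
Lemma vringM x y : O x -> O y -> O (x * y).
Proof. by case: OV => -[_ h] _ _ _; apply: h. Qed.
Lemma vring_const a : O (c a).
Proof. by case: OV => _ [h _] _ _; apply: h; exists a. Qed.
Lemma vring0 : O 0. Proof. by rewrite -(rmorph0 c); apply: vring_const. Qed.
Lemma vring1 : O 1. Proof. by rewrite -(rmorph1 c); apply: vring_const. Qed.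
Lemma vringN x : O x -> O (- x).
Proof. by move=> Ox; rewrite -sub0r; apply: vringB => //; apply: vring0. Qed.
Lemma vringD x y : O x -> O y -> O (x + y).
Proof. by move=> Ox Oy; rewrite -[y]opprK; apply: vringB => //; apply: vringN. Qed.
Lemma vringX x n : O x -> O (x ^+ n).
Proof.
by move=> Ox; elim: n => [|n IH]; [apply: vring1|rewrite exprS; apply: vringM].
Qed.
Lemma vring_or x : O x \/ O x^-1.
Proof.
have [->|x0] := eqVneq x 0; first by left; apply: vring0.
by case: OV => _ _ _; apply.
Qed.

(** In a field, the nonunits of O are the elements whose inverse falls outside O. Zero is listed
    apart, since [0^-1 = 0] lies in O. *)
Lemma max_idealE z : max_ideal O z <-> z = 0 \/ ~ O z^-1.
Proof.
split=> [[Oz zP]|].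
  have [->|z0] := eqVneq z 0; [by left|right=> /zP; apply].
  by rewrite mulfV.
case=> [->|nO]; first by split=> [|w _];
  [apply: vring0|rewrite mul0r => /esym/eqP; rewrite oner_eq0].
split=> [|w Ow zw1]; first by case: (vring_or z).
by apply: nO; rewrite -[z^-1]mulr1 -zw1 mulKf //;
  apply/eqP => z0; move/eqP: zw1; rewrite z0 mul0r eq_sym oner_eq0.
Qed.

Lemma max_ideal_val z : max_ideal O z -> O z. Proof. by case. Qed.

Lemma max_idealM x y : O x -> max_ideal O y -> max_ideal O (x * y).
Proof.
move=> Ox [Oy yP]; split=> [|w Ow]; first exact: vringM.
by rewrite mulrAC mulrC; apply: yP; apply: vringM.
Qed.

Lemma max_ideal0 : max_ideal O 0. Proof. by apply/max_idealE; left. Qed.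

Lemma max_ideal1 : ~ max_ideal O 1.
Proof.
by case/max_idealE => [/eqP|]; [rewrite oner_eq0|rewrite invr1; case; apply: vring1]. Qed.

Lemma max_idealN x : max_ideal O x -> max_ideal O (- x).
Proof.
by move=> mx; rewrite -mulN1r; apply: max_idealM => //; apply: vringN; apply: vring1. Qed.

(** One of x / y and y / x lies in O, so the sum is an O-multiple of y or of x. *)
Lemma max_idealD x y : max_ideal O x -> max_ideal O y -> max_ideal O (x + y).
Proof.
move=> mx my.
have [->|x0] := eqVneq x 0; first by rewrite add0r.
have [->|y0] := eqVneq y 0; first by rewrite addr0.
case: (vring_or (x / y)) => [Oxy|].
  rewrite (_ : x + y = (x / y + 1) * y); last by rewrite mulrDl mul1r divfK.
  by apply: max_idealM => //; apply: vringD => //; apply: vring1.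
rewrite invf_div => Oyx.
rewrite (_ : x + y = (1 + y / x) * x); last by rewrite mulrDl mul1r divfK.
by apply: max_idealM => //; apply: vringD => //; apply: vring1.
Qed.

Lemma max_idealB x y : max_ideal O x -> max_ideal O y -> max_ideal O (x - y).
Proof. by move=> mx my; apply: max_idealD => //; apply: max_idealN. Qed.

Lemma max_ideal_const a : max_ideal O (c a) -> a = 0.
Proof.
case/max_idealE => [/eqP|]; first by rewrite fmorph_eq0 => /eqP.
by rewrite -fmorphV; case; apply: vring_const.
Qed.

Lemma residue_val z a : res z a -> O z.
Proof.
move=> /max_ideal_val Oz; rewrite -[z](subrK (c a)).
by apply: vringD => //; apply: vring_const.
Qed.

Lemma residue_uniq z a b : res z a -> res z b -> a = b.
Proof.
move=> ha hb; apply/eqP; rewrite -subr_eq0; apply/eqP/max_ideal_const.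
have := max_idealB hb ha; congr (max_ideal _ _).
by rewrite rmorphB /= opprB addrC addrA subrK.
Qed.

Lemma residue_const a : res (c a) a.
Proof. by rewrite /residue subrr; apply: max_ideal0. Qed.

Lemma residue0 z : res z 0 <-> max_ideal O z.
Proof. by rewrite /residue rmorph0 subr0. Qed.

Lemma residueD z w a b : res z a -> res w b -> res (z + w) (a + b).
Proof. by rewrite /residue rmorphD opprD addrACA; apply: max_idealD. Qed.

Lemma residueN z a : res z a -> res (- z) (- a).
Proof. by rewrite /residue rmorphN -opprD; apply: max_idealN. Qed.

Lemma residueB z w a b : res z a -> res w b -> res (z - w) (a - b).
Proof. by move=> hz hw; apply: residueD => //; apply: residueN. Qed.

Lemma residueM z w a b : res z a -> res w b -> res (z * w) (a * b).
Proof.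
move=> hz hw; rewrite /residue.
rewrite (_ : _ - _ = z * (w - c b) + c b * (z - c a)).
  apply: max_idealD; apply: max_idealM => //; last exact: vring_const.
  exact: residue_val hz.
by rewrite rmorphM /= !mulrBr [c b * z]mulrC addrA subrK [c a * _]mulrC.
Qed.

Lemma residueX z a n : res z a -> res (z ^+ n) (a ^+ n).
Proof.
move=> hz; elim: n => [|n IH]; last by rewrite !exprS; apply: residueM.
by rewrite !expr0 -(rmorph1 c); apply: residue_const.
Qed.

Lemma residue_unit z a : res z a -> a != 0 -> z != 0 /\ O z^-1.
Proof.
move=> hz a0; have z0 : z != 0.
  apply: contraNneq a0 => z0; apply/eqP; apply: residue_uniq hz _.
  by rewrite residue0 z0; apply: max_ideal0.
split=> //; apply: contrapT => nO; move/eqP: a0; apply; apply: residue_uniq hz _.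
by rewrite residue0 max_idealE; right.
Qed.

Lemma residueV z a : res z a -> a != 0 -> res z^-1 a^-1.
Proof.
move=> hz a0; have [z0 Oz] := residue_unit hz a0.
rewrite /residue fmorphV /=.
rewrite (_ : _ - _ = - (z^-1 * c a^-1) * (z - c a)).
  by apply: max_idealM => //; apply: vringN; apply: vringM => //; apply: vring_const.
rewrite mulrBr fmorphV /= !mulNr opprK mulrAC mulVf // mul1r mulrAC -mulrA.
by rewrite mulfV ?fmorph_eq0 // mulr1 addrC.
Qed.

Lemma residue_horner (p : {poly k}) z a : res z a -> res (map_poly c p).[z] p.[a].
Proof.
move=> hz; elim/poly_ind: p => [|p b IH].
  by rewrite rmorph0 !horner0 residue0; apply: max_ideal0.
rewrite rmorphD rmorphM /= map_polyX map_polyC /= !hornerE.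
by apply: residueD; [apply: residueM|apply: residue_const].
Qed.

End Place.

(** If x in O' has residue a, then x - a is zero or its inverse lies outside O', hence outside O; so
    x - a lies in O, and x with it. *)
Lemma rational_place_sub (k L : fieldType) (c : {rmorphism k -> L}) (O O' : set L) :
  rational_place c O -> rational_place c O' -> O `<=` O' -> O = O'.
Proof.
move=> [OV _] [OV' res'] sOO'; apply/seteqP; split=> // x /res' [a].
case/(max_idealE OV') => [/eqP|nO].
  by rewrite subr_eq0 => /eqP ->; apply: vring_const OV _.
rewrite -[x](subrK (c a)); apply: (vringD OV); last exact: vring_const OV _.
by apply: max_ideal_val; apply/(max_idealE OV); right=> /sOO'.
Qed.

Section FiniteResidueField.
Variables (k : finFieldType) (L : fieldType) (c : {rmorphism k -> L}).

(* A rational function which is 1 on k and vanishes at infinity. *)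
Definition separator (z : L) : L := (z ^+ #|k| - z + 1)^-1.

Lemma residue_separator (O : set L) z :
  rational_place c O -> O z -> residue c O (separator z) 1.
Proof.
move=> [OV Or] /Or [a ha]; rewrite -invr1.
apply: (residueV OV); last exact: oner_neq0.
have -> : 1 = a ^+ #|k| - a + 1 :> k by rewrite expf_card subrr add0r.
apply: (residueD OV); last by rewrite -(rmorph1 c); apply: residue_const OV _.
by apply: (residueB OV) => //; apply: (residueX OV).
Qed.

Lemma residue_separator0 (O : set L) z :
  valuation_ring c O -> ~ O z -> residue c O (separator z) 0.
Proof.
move=> OV nOz.
have z0 : z != 0 by apply: contra_not_neq nOz => ->; apply: vring0 OV.
have mV : residue c O z^-1 0.
  by rewrite residue0 (max_idealE OV) invrK; right.
have := expf_card (0 : k); have := finNzRing_gt1 k; rewrite /separator.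
case: #|k| => [|[|n]] // _ _.
(* Here q = n + 2. With z^q factored out, the cofactor is a polynomial in 1/z with constant term 1,
   and 1/z has residue 0. *)
have -> : z ^+ n.+2 - z + 1 = z ^+ n.+2 * (1 - z^-1 ^+ n.+1 + z^-1 ^+ n.+2).
  have zzn m : z ^+ m * z^-1 ^+ m = 1 by rewrite -exprMn mulfV // expr1n.
  have zznS m : z ^+ m.+1 * z^-1 ^+ m = z by rewrite exprS -mulrA zzn mulr1.
  by rewrite mulrDr mulrBr mulr1 zzn zznS.
rewrite invfM -exprVn -[0](mul0r (1^-1 : k)); apply: (residueM OV).
  have -> : 0 = 0 ^+ n.+2 :> k by rewrite expr0n.
  exact: (residueX OV).
apply: (residueV OV); last exact: oner_neq0.
have -> : 1 = 1 - 0 ^+ n.+1 + 0 ^+ n.+2 :> k by rewrite !expr0n subr0 addr0.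
apply: (residueD OV); last exact: (residueX OV).
apply: (residueB OV); last exact: (residueX OV).
by rewrite -(rmorph1 c); apply: residue_const OV _.
Qed.

End FiniteResidueField.

(** * Finiteness of the set of places above a point *)

Lemma residue_prod (k L : fieldType) (c : {rmorphism k -> L}) (O : set L)
    (I : finType) (P : pred I) (z : I -> L) (a : I -> k) :
  valuation_ring c O -> (forall i, P i -> residue c O (z i) (a i)) ->
  residue c O (\prod_(i | P i) z i) (\prod_(i | P i) a i).
Proof.
move=> OV h; apply: (big_rec2 (fun x y => residue c O x y)) => [|i y1 y2 Pi hy].
  by rewrite -(rmorph1 c); apply: residue_const OV _.
by apply: (residueM OV) => //; apply: h.
Qed.

Lemma infinite_set_inj (T : Type) (A : set T) :
  infinite_set A -> exists2 f : nat -> T, injective f & forall n, A (f n).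
Proof.
elim/Ppointed: T A => T A; first by rewrite emptyE => /(_ (finite_set0 _)).
move=> /infiniteP /pcard_leP [f]; exists f => [m n|n]; last exact: funS.
by move=> fmn; apply: (@inj _ _ _ f); rewrite ?inE.
Qed.

(* Separators give elements whose residues at d + 1 places form an identity matrix; *)
(* a primitive K-linear relation between them would survive reduction.              *)
Lemma finite_places (k : finFieldType) (K L : fieldType)
    (c : {rmorphism k -> L}) (iota : {rmorphism K -> L}) (Phi : set (set L)) (d : nat) :
  (forall O, Phi O -> rational_place c O) ->
  (forall O O' z, Phi O -> Phi O' -> O (iota z) -> O' (iota z)) ->
  (forall e : 'I_d.+1 -> L, exists2 b : 'I_d.+1 -> K,
     exists i, b i != 0 & \sum_i iota (b i) * e i = 0) ->
  finite_set Phi.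
Proof.
move=> PhiR PhiK dep; apply: contrapT => /infinite_set_inj [f f_inj fPhi].
pose O (i : 'I_d.+1) := f (i : nat).
have PhiO i : Phi (O i) by apply: fPhi.
have OR i := PhiR _ (PhiO i); have OV i : valuation_ring c (O i) := (OR i).1.
have Oinj i j : O i = O j -> i = j.
  by move/f_inj/val_inj.
have [|z zP] := @choice _ _ (fun (ij : 'I_d.+1 * 'I_d.+1) z =>
    ij.1 != ij.2 -> O ij.1 z /\ ~ O ij.2 z).
  move=> [i j] /=; have [->|nij] := eqVneq i j; first by exists 0.
  have : ~ O i `<=` O j.
    by move/(rational_place_sub (OR i) (OR j))/Oinj/eqP; apply/negP.
  by move/existsNP => [z /not_implyP zP]; exists z.
(* As z (i, j) is regular at O i and has a pole at O j, every factor of e i is 1 at O i, and the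
   factor of index j vanishes at O j while the others stay regular. *)
pose e i := \prod_(j | j != i) separator k (z (i, j)).
have e_res i j : residue c (O j) (e i) (i == j)%:R.
  have [<-|nij] := eqVneq i j.
    suff: residue c (O i) (e i) (\prod_(l | l != i) 1) by rewrite big1_eq.
    apply: (residue_prod (OV i)) => l nli; apply: (residue_separator (OR i)).
    by have [] := zP (i, l); rewrite // eq_sym.
  rewrite /e (bigD1 j) 1?eq_sym //= residue0 mulrC.
  apply: (max_idealM (OV j)); last first.
    rewrite -(residue0 c); apply: (residue_separator0 (OV j)).
    by have [] := zP (i, j).
  have [|a ha] := @choice _ _ (fun l a => residue c (O j) (separator k (z (i, l))) a).
    move=> l; have [Oz|nOz] := pselect (O j (z (i, l))).
      by exists 1; apply: (residue_separator (OR j)).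
    by exists 0; apply: (residue_separator0 (OV j)).
  exact: (residue_val (OV j) (residue_prod (OV j) (fun l _ => ha l))).
have [b [i0 bi0] sum0] := dep e.
(* Divisibility in K over the valuation ring that O ord0 induces on K. It is a total preorder, so
   some coefficient b i divides all the others; dividing by it makes the relation primitive, with u
   i = 1. *)
pose r (x y : K) := `[< exists2 u, O ord0 (iota u) & y = x * u >].
have r_refl : reflexive r.
  move=> x; apply/asboolP; exists 1; last by rewrite mulr1.
  by rewrite rmorph1; apply: (vring1 (OV ord0)).
have r_trans : transitive r.
  move=> y x z' /asboolP [u Ou ->] /asboolP [v Ov ->]; apply/asboolP.
  by exists (u * v); [rewrite rmorphM; apply: (vringM (OV ord0))|rewrite mulrA].
have r_total : total r.
  move=> x y; apply/orP; have [->|x0] := eqVneq x 0.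
    right; apply/asboolP; exists 0; last by rewrite mulr0.
    by rewrite rmorph0; apply: (vring0 (OV ord0)).
  have [->|y0] := eqVneq y 0.
    left; apply/asboolP; exists 0; last by rewrite mulr0.
    by rewrite rmorph0; apply: (vring0 (OV ord0)).
  have [h|h] := vring_or (OV ord0) (iota (y / x)); [left|right]; apply/asboolP.
    by exists (y / x); rewrite // mulrC divfK.
  move: h; rewrite -fmorphV invf_div => h.
  by exists (x / y); rewrite // mulrC divfK.
have [i _ imin] := @extremumP _ _ r i0 xpredT b r_refl r_trans r_total isT.
have bi_neq0 : b i != 0.
  apply: contraNneq bi0 => bi; have /asboolP [u _ ->] := imin i0 isT.
  by rewrite bi mul0r.
have [|u uP] := @choice _ _ (fun j u => O ord0 (iota u) /\ b j = b i * u).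
  by move=> j; have /asboolP [u Ou bj] := imin j isT; exists u.
have ui : u i = 1 by apply: (mulfI bi_neq0); rewrite mulr1 -(uP i).2.
have sum0' : \sum_j iota (u j) * e j = 0.
  apply: (@mulfI _ (iota (b i))); first by rewrite fmorph_eq0.
  rewrite mulr0 -{}[RHS]sum0 mulr_sumr; apply: eq_bigr => j _.
  by rewrite (uP j).2 rmorphM mulrA.
(* All places of Phi induce the same ring on K, so the u j are regular at O i as well. There the
   terms with j != i vanish, which forces the residue of e i to be 0 instead of 1. *)
have Ou j : O i (iota (u j)) by apply: (PhiK (O ord0)) (uP j).1.
have : max_ideal (O i) (e i).
  move: sum0'; rewrite (bigD1 i) //= ui rmorph1 mul1r => /eqP.
  rewrite addr_eq0 => /eqP ->; apply: (max_idealN (OV i)).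
  apply: big_ind => [|x y|j nji]; [exact: (max_ideal0 (OV i))
    |exact: (max_idealD (OV i))|].
  apply: (max_idealM (OV i) (Ou j)); rewrite -(residue0 c).
  by have := e_res j i; rewrite (negPf nji).
rewrite -(residue0 c) => /(residue_uniq (OV i) (e_res i i))/eqP.
by rewrite eqxx oner_eq0.
Qed.

(** * Places above the points of the projective line *)

Lemma fractionP (R : idomainType) (z : {fraction R}) :
  exists p q, q != 0 /\ z = FracField.tofrac p / FracField.tofrac q.
Proof.
elim/quotW: z => r; exists (frac r).1, (frac r).2.
have d0 := denom_ratioP r; split=> //.
apply: (@mulIf _ (FracField.tofrac (frac r).2)); first by rewrite tofrac_eq0.
rewrite divfK ?tofrac_eq0 // -[LHS]/(FracField.mul _ _) /FracField.tofrac; unlock.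
rewrite -FracField.pi_mul; apply/eqP; rewrite FracField.equivf_def /FracField.mulf.
by rewrite !numden_Ratio ?mulf_neq0 ?oner_neq0 ?denom_ratioP // !mulr1 mulrC.
Qed.

(** The order at t is kept as two natural exponents: [z * t ^+ m = t ^+ n * u] stands for z = t^(n -
    m) u. Quotients add the exponents crosswise. *)
Lemma unit_part_div (K : fieldType) (t p q u v : K) (m n m' n' : nat) :
  t != 0 -> q != 0 -> p * t ^+ m = t ^+ n * u -> q * t ^+ m' = t ^+ n' * v ->
  p / q * t ^+ (m + n') = t ^+ (n + m') * (u / v).
Proof.
move=> t0 q0 pE qE; have v0 : v != 0.
  have : t ^+ n' * v != 0 by rewrite -qE mulf_neq0 ?expf_neq0.
  by rewrite mulf_eq0 negb_or => /andP[].
apply: (mulIf (mulf_neq0 q0 v0)).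
transitivity ((p * t ^+ m) * (t ^+ n' * v)).
  by rewrite exprD -[in RHS](divfK q0 p); ring.
by rewrite pE -qE exprD -{1}(divfK v0 u); ring.
Qed.

Section RationalFunctionPlaces.
Variables (F : fieldType) (L : fieldType).
Local Notation Fx := {fraction {poly F}}.
Local Notation tofrac := (@FracField.tofrac {poly F}).
Variable iota : {rmorphism Fx -> L}.

Let j : {rmorphism F -> Fx} := (tofrac \o @polyC F).
Let c : {rmorphism F -> L} := (iota \o tofrac \o @polyC F).

Lemma tofrac_horner (p : {poly F}) : (map_poly j p).[tofrac 'X] = tofrac p.
Proof.
elim/poly_ind: p => [|p b IH]; first by rewrite !rmorph0 horner0.
by rewrite !rmorphD !rmorphM /= map_polyX map_polyC /= !hornerE IH.
Qed.

Lemma x_param_neq0 (P : option F) : x_param P != 0.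
Proof.
case: P => [a|] /=; first by rewrite tofrac_eq0 polyXsubC_eq0.
by rewrite invr_eq0 tofrac_eq0 polyX_eq0.
Qed.

Lemma residue_tofrac (O : set L) (a : F) (p : {poly F}) :
  valuation_ring c O -> max_ideal O (iota (x_param (Some a))) ->
  residue c O (iota (tofrac p)) p.[a].
Proof.
move=> OV Oa; rewrite -tofrac_horner -horner_map /= -map_poly_comp.
apply: (residue_horner OV); rewrite /residue.
by move: Oa; rewrite /x_param rmorphB rmorphB.
Qed.

(** The exponents, u and b depend on P alone and serve all places above P at once; this uniformity
    is what [vring_above_eq] rests on. *)
Lemma poly_unit_part (P : option F) (p : {poly F}) : p != 0 ->
  exists m n u b, [/\ tofrac p * x_param P ^+ m = x_param P ^+ n * u, b != 0 &
    forall O, valuation_ring c O -> max_ideal O (iota (x_param P)) ->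
      residue c O (iota u) b].
Proof.
move=> p0; case: P => [a|].
  have [n [q + pE]] := multiplicity_XsubC p a; rewrite p0 /= => qa.
  exists 0, n, (tofrac q), q.[a]; split=> // [|O OV Oa]; last exact: residue_tofrac.
  by rewrite mulr1 pE rmorphM rmorphXn mulrC.
(* At infinity, p(x) x^(-d) = r(1/x) for the reversed polynomial r, whose value at 0 is the leading
   coefficient of p. *)
set d := (size p).-1.
have sp : size p = d.+1 by rewrite prednK // lt0n size_poly_eq0.
set r := \poly_(i < d.+1) p`_(d - i).
exists d, 0, (map_poly j r).[x_param None], r.[0]; split.
- rewrite mul1r -tofrac_horner (@horner_coef_wide _ d.+1) ?size_map_poly ?sp //.
  rewrite (@horner_coef_wide _ d.+1) ?size_map_poly ?size_poly //.
  rewrite mulr_suml (reindex_inj rev_ord_inj) /=; apply: eq_bigr => i _.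
  rewrite !coef_map coef_poly ltn_ord subSS /= -mulrA; congr (_ * _).
  have lid : (i <= d)%N by rewrite -ltnS.
  rewrite -[X in _ * _ ^+ X](subnK lid).
  rewrite exprD mulrA -exprMn mulfV ?expr1n ?mul1r //.
  by rewrite tofrac_eq0 polyX_eq0.
- by rewrite horner_coef0 coef_poly subn0 /= -/(lead_coef p) lead_coef_eq0.
- move=> O OV Oinf; rewrite -horner_map /= -map_poly_comp.
  by apply: (residue_horner OV); rewrite residue0.
Qed.

Lemma unit_part (P : option F) (z : Fx) : z != 0 ->
  exists m n u b, [/\ z * x_param P ^+ m = x_param P ^+ n * u, b != 0 &
    forall O, valuation_ring c O -> max_ideal O (iota (x_param P)) ->
      residue c O (iota u) b].
Proof.
have [p [q [q0 ->]]] := fractionP z; rewrite mulf_eq0 negb_or tofrac_eq0 => /andP[p0 _].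
have [m [n [u [b [pE b0 ub]]]]] := poly_unit_part P p0.
have [m' [n' [v [b' [qE b'0 vb]]]]] := poly_unit_part P q0.
exists (m + n')%N, (n + m')%N, (u / v), (b / b'); split.
- by apply: unit_part_div pE qE; rewrite ?tofrac_eq0 // x_param_neq0.
- by rewrite mulf_neq0 ?invr_eq0.
- move=> O OV OP; rewrite rmorphM fmorphV /=; apply: (residueM OV); first exact: ub.
  by apply: (residueV OV) => //; apply: vb.
Qed.

(** Write z = t^(n - m) u with t the parameter at P. If m > n, then u = z t^(m - n) would have
    residue 0 at O, against b <> 0. So m <= n, and z is regular at every place above P. *)
Lemma vring_above_eq (P : option F) (O O' : set L) (z : Fx) :
  valuation_ring c O -> valuation_ring c O' ->
  max_ideal O (iota (x_param P)) -> max_ideal O' (iota (x_param P)) ->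
  O (iota z) -> O' (iota z).
Proof.
move=> OV OV' OP OP' Oz.
have [->|z0] := eqVneq z 0; first by rewrite rmorph0; apply: (vring0 OV').
have [m [n [u [b [zE b0 ub]]]]] := unit_part P z0.
have {}ub' := ub _ OV' OP'; have {}ub := ub _ OV OP.
have pi0 : iota (x_param P) != 0 by rewrite fmorph_eq0 x_param_neq0.
set pi := iota (x_param P) in OP OP' pi0 *.
have {}zE : iota z * pi ^+ m = pi ^+ n * iota u by rewrite -!rmorphXn -!rmorphM zE.
have [lmn|ltnm] := leqP m n.
  have -> : iota z = pi ^+ (n - m) * iota u.
    apply: (mulIf (expf_neq0 m pi0)); rewrite zE -{1}(subnK lmn) exprD.
    by rewrite mulrAC.
  apply: (vringM OV'); last exact: residue_val ub'.
  by apply: (vringX OV'); apply: max_ideal_val OP'.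
exfalso; move/eqP: b0; apply; apply: (residue_uniq OV ub); rewrite residue0.
have -> : iota u = iota z * pi ^+ (m - n.+1) * pi.
  apply: (mulIf (expf_neq0 n pi0)); rewrite mulrC -zE -{1}(subnK ltnm) addnS.
  by rewrite exprS exprD; ring.
apply: (max_idealM OV _ OP); apply: (vringM OV) => //.
by apply: (vringX OV); apply: max_ideal_val OP.
Qed.

End RationalFunctionPlaces.

(** * Components, their degrees, and finiteness of the fibres *)

(** K[y]/(g) has dimension d = deg g over K, so the coordinate matrix of d + 1 elements has a
    nonzero left kernel. *)
Lemma qpoly_dependent (K : fieldType) (g : {poly K}) (gI : monic_irreducible_poly g)
    (e : 'I_(size (mk_monic g)).-1.+1 -> {poly %/ g with gI}) :
  exists2 b : 'I_(size (mk_monic g)).-1.+1 -> K,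
    exists i, b i != 0 & \sum_i (qfpoly_const gI (b i) * e i) = 0.
Proof.
set d := (size _).-1 in e *.
pose M : 'M[K]_(d.+1, d) := \matrix_i npoly_rV (e i : {poly_d K}).
have /rowV0Pn [v /sub_kermxP vM v0] : kermx M != 0.
  by rewrite kermx_eq0 /row_free;
    apply: contraTN (rank_leq_col M) => /eqP ->; rewrite ltnn.
exists (fun i => v 0 i); first by have /rV0Pn [i vi] := v0; exists i.
apply: (can_inj (@npoly_rV_K _ _)); rewrite -[RHS]/(npoly_rV (0 : {poly_d K})).
apply/rowP => l; have /rowP/(_ l) := vM; rewrite !mxE => vMl.
rewrite coef0 -{}[RHS]vMl.
transitivity (\sum_i (qfpoly_const gI (v 0 i) * e i : {poly_d K})`_l).
  by rewrite -coefn_sum.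
apply: eq_bigr => i _; rewrite !mxE poly_of_qpolyM /= mul_polyC.
rewrite Pdiv.CommonRing.rmodp_small ?coefZ //.
by rewrite (leq_ltn_trans (size_scale_leq _ _)) ?size_mk_monic.
Qed.

(** The proof of irreducibility occurs in the type of the function field, so proofs obtained from
    different sources must be identified. *)
Lemma monic_irreducible_irrelevance (K : fieldType) (g : {poly K})
  (gI gI' : monic_irreducible_poly g) : gI = gI'.
Proof.
by case: gI gI' => [u v] [u' v'];
  rewrite (Prop_irrelevance u u') (bool_irrelevance v v').
Qed.

Lemma monic_irreducible_eqp (K : fieldType) (g h : {poly K}) :
  monic_irreducible_poly g -> monic_irreducible_poly h -> g %| h -> g = h.
Proof.
move=> [gI gM] [hI hM] gh; apply/eqP; rewrite -eqp_monic //.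
by apply: apply_irredp gh => //; have [+ _] := gI; case: size => [|[]].
Qed.

(** Distinct monic irreducible divisors are coprime, so the product of n of them still divides G,
    and its degree is at least n. *)
Lemma finite_monic_irreducible_divisors (K : fieldType) (G : {poly K}) :
  G != 0 ->
  finite_set [set g | (g %| G)%R /\ exists gI : monic_irreducible_poly g, True].
Proof.
move=> G0; apply: contrapT => /infinite_set_inj [f f_inj fP].
suff fG n : [/\ (\prod_(i < n) f i) %| G, (\prod_(i < n) f i) \is monic &
    (n < size (\prod_(i < n) f i)%R)%N].
  by have [/(dvdp_leq G0) h _] := fG (size G); rewrite ltnNge h.
elim: n => [|n [IHd IHm IHs]].
  by rewrite big_ord0 dvd1p monic1 size_poly1.
have [fdvd [[fI fM] _]] := fP n.
have ndvd m : (m <= n)%N -> ~~ (f n %| \prod_(i < m) f i).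
  elim: m => [_|m IH mn].
    by rewrite big_ord0 dvdp1; have [+ _] := fI; case: size => [|[]].
  rewrite big_ord_recr /=; apply: contra (IH (ltnW mn)) => dvd.
  have [_ [[hI hM] _]] := fP m.
  have cop : coprimep (f n) (f m).
    rewrite irreducible_poly_coprime //; apply/negP => /monic_irreducible_eqp fnm.
    have /f_inj nm : f n = f m by apply: fnm.
    by rewrite nm ltnn in mn.
  by rewrite -(Gauss_dvdpl _ cop).
rewrite big_ord_recr /= mulrC; split.
- by rewrite Gauss_dvdp ?fdvd ?IHd // irreducible_poly_coprime // ndvd.
- by rewrite monicMl.
rewrite size_monicM ?monic_neq0 // -ltnS prednK; last first.
  by rewrite addn_gt0 (ltnW fI.1).
by rewrite -addn2 addnC; apply: leq_add; [exact: fI.1|].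
Qed.

Section ConstMorph.
Variable F : fieldType.
Local Notation Fx := {fraction {poly F}}.
Local Notation tofrac := (@FracField.tofrac {poly F}).

Definition qfpoly_morph (g : {poly Fx}) (gI : monic_irreducible_poly g) :
  {rmorphism Fx -> {poly %/ g with gI}} :=
  [the {rmorphism Fx -> {poly %/ g}} of qpolyC g].

Definition const_fun_morph (g : {poly Fx}) (gI : monic_irreducible_poly g) :
  {rmorphism F -> {poly %/ g with gI}} := (qfpoly_morph gI \o tofrac \o @polyC F).

End ConstMorph.

Section RationalPointsAbove.
Variable F : finFieldType.
Local Notation Fx := {fraction {poly F}}.
Local Notation tofrac := (@FracField.tofrac {poly F}).

Lemma finite_rational_places_above (g : {poly Fx})
    (gI : monic_irreducible_poly g) (P : option F) :
  finite_set [set O : set {poly %/ g with gI} |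
    @rational_place F {poly %/ g with gI} (const_fun g) O /\
    @max_ideal {poly %/ g with gI} O (qpolyC g (x_param P))].
Proof.
apply: (@finite_places F Fx {poly %/ g with gI} (const_fun_morph gI) (qfpoly_morph gI)).
- by move=> O [].
- move=> O O' z [[OV _] OP] [[OV' _] OP'].
  exact: (@vring_above_eq _ _ (qfpoly_morph gI) P O O' z OV OV' OP OP').
- exact: (@qpoly_dependent _ g gI).
Qed.

Lemma finite_rational_points_above (N i j k : nat) (lam : F) (P : option F) :
  (0 < N)%N ->
  finite_set (rational_points_above N i j k lam P).
Proof.
move=> N_gt0; pose G := curve_poly N i j k lam.
have G0 : G != 0 by apply: monic_neq0; rewrite /G /curve_poly monicXnsubC.
pose pts (g : {poly Fx}) : set (Defs.point F) :=
  [set Q | Defs.comp Q = g /\ rational_points_above N i j k lam P Q].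
apply: (@sub_finite_set _ _ (\bigcup_(g in [set g | g %| G /\
    exists gI : monic_irreducible_poly g, True]) pts g)).
  move=> Q QP; exists (Defs.comp Q) => //.
  by case: (QP) => -[gG [gI _]] _; split=> //; exists gI.
apply: bigcup_finite => [|g [gG [gI _]]].
  exact: finite_monic_irreducible_divisors.
apply: (@sub_finite_set _ _ (@Point F g @` [set O : set {poly %/ g} |
   @rational_place F {poly %/ g with gI} (const_fun g) O /\
   @max_ideal {poly %/ g with gI} O (qpolyC g (x_param P))])).
  move=> [h O] [/= hg hQ]; subst h; exists O => //.
  have [[_ [/= hI hR]] [/= hI' hP]] := hQ; split.
    by rewrite (monic_irreducible_irrelevance gI hI).
  by rewrite (monic_irreducible_irrelevance gI hI').
apply: finite_image; exact: finite_rational_places_above.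
Qed.

End RationalPointsAbove.

(** * Local rings that are valuation rings *)

Section LocalRing.
Variables (k L : fieldType) (c : {rmorphism k -> L}) (B : comNzRingType).
Variables (e : {rmorphism B -> L}) (red : {rmorphism B -> k}) (const : k -> B) (t : B).
Hypothesis e_const : forall a, e (const a) = c a.
Hypothesis red_const : forall a, red (const a) = a.
Hypothesis red_ker : forall A, e A = 0 -> red A = 0.

(** The localization at the kernel of [red], realized inside L. In the application B is F[x, y], [e]
    maps it to the function field of a component, and [red] evaluates at a point (a, w). *)
Definition local_ring : set L :=
  [set z | exists A D, red D != 0 /\ z = e A / e D].

Lemma red_neq0 A : red A != 0 -> e A != 0.
Proof. by apply: contra_neq; apply: red_ker. Qed.

Lemma residue_local_ring A D : red D != 0 ->
  residue c local_ring (e A / e D) (red A / red D).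
Proof.
move=> D0; have eD0 := red_neq0 D0.
rewrite /residue; have := divfK D0 (red A); move: (red A / red D) => a aD.
have -> : e A / e D - c a = e (A - const a * D) / e D.
  by rewrite rmorphB rmorphM e_const mulrBl mulfK.
have redA : red (A - const a * D) = 0.
  by rewrite rmorphB rmorphM red_const aD subrr.
split; first by exists (A - const a * D), D.
move=> _ [A' [D' [D'0 ->]]] /eqP; have eD'0 := red_neq0 D'0.
rewrite mulf_div -rmorphM -(rmorphM e D) -subr_eq0.
rewrite -[1](@mulfV _ (e (D * D'))); last by rewrite rmorphM mulf_neq0.
rewrite -mulrBl mulf_eq0 invr_eq0 -rmorphB => /orP[/eqP/red_ker/eqP|].
  by rewrite rmorphB !rmorphM redA mul0r sub0r oppr_eq0
    -rmorphM rmorphM mulf_eq0 (negPf D0) (negPf D'0).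
by rewrite rmorphM mulf_eq0 (negPf eD0) (negPf eD'0).
Qed.

Lemma local_ring_sub (O : set L) : valuation_ring c O ->
  (forall A, residue c O (e A) (red A)) -> local_ring `<=` O.
Proof.
move=> OV Ored _ [A [D [D0 ->]]].
by apply: (residue_val OV); apply: (residueM OV); [|apply: (residueV OV)].
Qed.

Hypothesis e_frac : forall z, exists A D, e D != 0 /\ z = e A / e D.
Hypothesis et0 : e t != 0.
Hypothesis redt : red t = 0.
Hypothesis red_principal : forall A, red A = 0 ->
  exists h A', red h != 0 /\ e (h * A) = e (t * A').
Hypothesis e_order : forall A, e A != 0 ->
  exists U n V, red V != 0 /\ e (A * U) = e (t ^+ n * V).

(** Factors t are split off by [red_principal] as long as the cofactor vanishes at the point. This
    stops because [e_order] makes A divide t^n times a unit, and each split lowers n. *)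
Lemma local_unit_part A : e A != 0 ->
  exists n A1 D, [/\ red A1 != 0, red D != 0 & e (D * A) = e (t ^+ n * A1)].
Proof.
move=> /e_order [U [n [V [V0 AU]]]].
elim: n A V V0 AU => [|n IH] A V V0 AU.
  exists 0, A, 1; rewrite rmorph1 oner_neq0 expr0; split=> //.
  apply: contraNneq V0 => A0; have /red_ker : e (V - A * U) = 0.
    by rewrite rmorphB AU expr0 mul1r subrr.
  by rewrite rmorphB rmorphM A0 mul0r subr0 => ->.
have [A0|A0] := eqVneq (red A) 0; last first.
  by exists 0, A, 1; rewrite rmorph1 oner_neq0 expr0.
have [h [A' [h0 hA]]] := red_principal A0.
have [||m [A1 [D [A10 D0 DA]]]] := IH A' (h * V).
- by rewrite rmorphM mulf_neq0.
- apply: (mulfI et0); rewrite -!rmorphM !mulrA (rmorphM e _ U) -hA -rmorphM.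
  by rewrite -mulrA rmorphM AU -rmorphM exprS; congr (e _); ring.
exists m.+1, A1, (D * h); split=> //; first by rewrite rmorphM mulf_neq0.
rewrite -mulrA rmorphM hA -rmorphM.
have -> : D * (t * A') = t * (D * A') by ring.
by rewrite rmorphM DA -rmorphM exprS mulrA.
Qed.

Lemma local_ring_rational : rational_place c local_ring.
Proof.
have OA A : local_ring (e A).
  by exists A, 1; rewrite !rmorph1 divr1 oner_neq0.
split; last first.
  by move=> _ [A [D [D0 ->]]]; exists (red A / red D); apply: residue_local_ring.
split.
- split=> _ _ [A [D [D0 ->]]] [A' [D' [D'0 ->]]].
    exists (A * D' - A' * D), (D * D'); rewrite rmorphM mulf_neq0 //; split=> //.
    have := red_neq0 D0; have := red_neq0 D'0 => eD'0 eD0.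
    by rewrite -[- (e A' / e D')]mulNr addf_div // rmorphB !rmorphM mulNr.
  exists (A * A'), (D * D'); rewrite rmorphM mulf_neq0 //; split=> //.
  by rewrite !rmorphM mulf_div.
- split=> [_ [a _ <-]|]; first by rewrite -e_const; apply: OA.
  move=> /(_ _ (OA t)) [a _ cat]; move/eqP: et0; apply.
  rewrite -cat -e_const; have /red_ker : e (t - const a) = 0.
    by rewrite rmorphB e_const cat subrr.
  by rewrite rmorphB redt red_const sub0r => /eqP; rewrite oppr_eq0 => /eqP ->;
    rewrite e_const rmorph0.
- split=> // /(_ (e t)^-1 I) [A [D [D0 tAD]]]; have eD0 := red_neq0 D0.
  move/eqP: D0; apply.
  have /red_ker : e (D - A * t) = 0.
    rewrite rmorphB rmorphM; apply/eqP; rewrite subr_eq0.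
    by rewrite -[e A](divfK eD0) -tAD mulrAC mulVf // mul1r.
  by rewrite rmorphB rmorphM redt mulr0 subr0.
- move=> z; have [A [D [eD0 ->]]] := e_frac z.
  rewrite mulf_eq0 invr_eq0 (negPf eD0) orbF => eA0.
  have [n [A1 [A2 [A10 A20 EA]]]] := local_unit_part eA0.
  have [m [D1 [D2 [D10 D20 ED]]]] := local_unit_part eD0.
  have tn0 l : e (t ^+ l) != 0 by rewrite rmorphXn expf_neq0.
  (* Numerator and denominator are units times t^l' and t^l, so their quotient is regular when l <=
     l'; otherwise its inverse is. *)
  have key (A' D' A1' A2' D1' D2' : B) l l' : (l <= l')%N -> e D' != 0 ->
      red A2' != 0 -> red D1' != 0 ->
      e (A2' * A') = e (t ^+ l' * A1') -> e (D2' * D') = e (t ^+ l * D1') ->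
      local_ring (e A' / e D').
    move=> ll eD'0 A20' D10' EA' ED'.
    exists (t ^+ (l' - l) * A1' * D2'), (A2' * D1').
    rewrite rmorphM mulf_neq0 //; split=> //.
    have eA2 := red_neq0 A20'; have eD1 := red_neq0 D10'.
    apply/eqP; rewrite eqr_div //; last by rewrite rmorphM mulf_neq0.
    apply/eqP; apply: (mulfI (tn0 l)).
    rewrite -!rmorphM.
    transitivity (e (A2' * A') * e (t ^+ l * D1'));
      first by rewrite -rmorphM; congr (e _); ring.
    rewrite EA' -ED' -{1}(subnK ll) exprD -rmorphM; congr (e _); ring.
  have [lmn|lnm] := leqP m n.
    by left; apply: key lmn eD0 A20 D10 EA ED.
  by right; rewrite invf_div; apply: key (ltnW lnm) eA0 D20 A10 ED EA.
Qed.

End LocalRing.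

(** * Polynomials in y over F(x) near x = a *)

Lemma scaled_poly_image (R : idomainType) (K : fieldType) (j : {rmorphism R -> K}) :
  (forall z, exists p q, j q != 0 /\ z = j p / j q) ->
  forall Q : {poly K}, exists d Q1, j d != 0 /\ j d *: Q = map_poly j Q1.
Proof.
move=> jP; elim/poly_ind => [|Q z [d [Q1 [d0 QE]]]].
  by exists 1, 0; rewrite rmorph1 oner_neq0 rmorph0 scaler0.
have [p [q [q0 ->]]] := jP z.
exists (d * q), (q%:P * Q1 * 'X + (d * p)%:P); rewrite rmorphM mulf_neq0 //; split=> //.
rewrite scalerDr rmorphD; congr (_ + _).
  by rewrite !rmorphM /= map_polyX map_polyC /= -QE mul_polyC
    scalerA scalerAl [j q * _]mulrC.
have jE : j d * j q * (j p / j q) = j (d * p).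
  by rewrite rmorphM -mulrA [j q * _]mulrC divfK.
by rewrite /= map_polyC /= -mul_polyC -polyCM jE.
Qed.

Lemma irreducible_monicZ (K : fieldType) (H : {poly K}) :
  irreducible_poly H -> monic_irreducible_poly ((lead_coef H)^-1 *: H).
Proof.
move=> HI; have H0 := irredp_neq0 HI.
have lH : (lead_coef H)^-1 != 0 by rewrite invr_eq0 lead_coef_eq0.
split; last by rewrite monicE lead_coefZ mulVf // lead_coef_eq0.
split=> [|q q1]; first by rewrite size_scale // HI.1.
rewrite dvdpZr // => /(HI.2 _ q1)/eqp_trans; apply.
by rewrite eqp_sym eqp_scale.
Qed.

Lemma scale_mul3 (R : comNzRingType) (p q r : {poly R}) (a b c : R) :
  (a *: p) * (b *: q) * (c *: r) = (a * b * c) *: (r * (p * q)).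
Proof. by rewrite -!mul_polyC !rmorphM; ring. Qed.

Section PlaneCurve.
Variable F : fieldType.
Local Notation Fx := {fraction {poly F}}.
Local Notation tofrac := (@FracField.tofrac {poly F}).
Local Notation emb := (map_poly tofrac).

Definition spec_x (a : F) : {rmorphism {poly {poly F}} -> {poly F}} :=
  map_poly (horner_eval a).

Definition eval_xy (a w : F) : {rmorphism {poly {poly F}} -> F} :=
  horner_eval w \o spec_x a.

Lemma tofrac_inj : injective tofrac.
Proof. by move=> p q /eqP; rewrite tofrac_eq => /eqP. Qed.

Lemma spec_xC a (p : {poly F}) : spec_x a p%:P = (p.[a])%:P.
Proof. by rewrite /spec_x /= map_polyC. Qed.

Lemma coef_spec_x a (A : {poly {poly F}}) i : (spec_x a A)`_i = (A`_i).[a].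
Proof. by rewrite /spec_x coef_map. Qed.

Lemma eval_xyC a w (p : {poly F}) : eval_xy a w p%:P = p.[a].
Proof. by rewrite /= spec_xC /horner_eval hornerC. Qed.

Lemma eval_xyX a w : eval_xy a w 'X = w.
Proof. by rewrite /= /spec_x /= map_polyX /horner_eval hornerX. Qed.

Lemma eval_xyE a w A : eval_xy a w A = A.[w%:P].[a].
Proof.
by have := horner_map (horner_eval a) A w%:P; rewrite /= /horner_eval hornerC.
Qed.

Lemma spec_x_eq0 (a : F) (A : {poly {poly F}}) : spec_x a A = 0 ->
  exists A', A = ('X - a%:P)%:P * A'.
Proof.
move=> A0; exists (\poly_(i < size A) (A`_i %/ ('X - a%:P))).
apply/polyP => i; rewrite coefCM coef_poly.
have [iA|Ai] := ltnP; last by rewrite nth_default // mulr0.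
rewrite mulrC divpK // dvdp_XsubCl; apply/rootP.
by have /polyP/(_ i) := A0; rewrite coef_spec_x coef0.
Qed.

Lemma common_denominator (Q : {poly Fx}) :
  exists d Q1, d != 0 /\ tofrac d *: Q = emb Q1.
Proof.
have [z|d [Q1 [d0 QE]]] := @scaled_poly_image _ _ tofrac _ Q; last first.
  by exists d, Q1; rewrite -tofrac_eq0.
by have [p [q [q0 zE]]] := fractionP z; exists p, q; rewrite tofrac_eq0.
Qed.

(* Local Gauss lemma: a denominator minimal at x = a. *)
Lemma minimal_denominator (Q : {poly Fx}) (a : F) :
  exists d Q1, [/\ d != 0, tofrac d *: Q = emb Q1 & d.[a] != 0 \/ spec_x a Q1 != 0].
Proof.
have [d [Q1 [d0 QE]]] := common_denominator Q.
have [n] := ubnP (size d); elim: n d Q1 d0 QE => // n IH d Q1 d0 QE.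
rewrite ltnS => dn.
have [da|da] := eqVneq d.[a] 0; last by exists d, Q1; split=> //; left.
have [Q1a|Q1a] := eqVneq (spec_x a Q1) 0; last by exists d, Q1; split=> //; right.
have [Q2 Q1E] := spec_x_eq0 Q1a.
have /factor_theorem [d' dE] : root d a by apply/rootP.
have d'0 : d' != 0 by apply: contraNneq d0 => d'0; rewrite dE d'0 mul0r.
apply: (IH d' Q2 d'0); last by rewrite (leq_trans _ dn) // dE
  size_mul ?polyXsubC_eq0 // size_XsubC addn2.
have t0 : tofrac ('X - a%:P) != 0 by rewrite tofrac_eq0 polyXsubC_eq0.
apply: (scalerI t0); rewrite scalerA -rmorphM mulrC -dE QE Q1E rmorphM /=.
by rewrite map_polyC mul_polyC.
Qed.

(** As Q is monic, d is itself a coefficient of Q1, so d(a) <> 0 also gives a nonzero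
    specialization. *)
Lemma monic_denominator (Q : {poly Fx}) (a : F) : Q \is monic ->
  exists d Q1, tofrac d *: Q = emb Q1 /\ spec_x a Q1 != 0.
Proof.
move=> /monicP Qm; have [d [Q1 [d0 QE h]]] := minimal_denominator Q a.
exists d, Q1; split=> //; case: h => // da; apply: contraNneq da => Q10.
have -> : d = Q1`_(size Q).-1.
  by apply: tofrac_inj; rewrite -coef_map -QE coefZ -/(lead_coef Q) Qm mulr1.
by have /polyP/(_ (size Q).-1) := Q10; rewrite coef_spec_x coef0 => ->.
Qed.

Lemma monic_spec_x_neq0 (a : F) (G : {poly {poly F}}) : G \is monic -> spec_x a G != 0.
Proof.
move=> /monicP Gm; apply/eqP => /polyP/(_ (size G).-1).
by rewrite coef_spec_x -/(lead_coef G) Gm hornerC coef0 => /eqP; rewrite oner_eq0.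
Qed.

(* (a, w) is a point of the closed subscheme cut out by H. *)
Definition through (a w : F) (H : {poly Fx}) :=
  forall A, H %| emb A -> eval_xy a w A = 0.

(** From A = Q G with Q over F(x), a minimal denominator gives d A = Q1 G over F[x]. If d(a) = 0,
    then Q1 specializes to 0, since G stays nonzero at x = a; so d(a) <> 0, and the identity can be
    evaluated at (a, w). *)
Lemma through_monic (a w : F) (G : {poly {poly F}}) :
  G \is monic -> eval_xy a w G = 0 -> through a w (emb G).
Proof.
move=> Gm Gw A /dvdpP [Q AE].
have [d [Q1 [d0 QE h]]] := minimal_denominator Q a.
have dA : d%:P * A = Q1 * G.
  apply: (map_inj_poly tofrac_inj (rmorph0 _));
  rewrite !rmorphM /= map_polyC /= mul_polyC.
  by rewrite AE scalerAl QE.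
have da : d.[a] != 0.
  case: h => // Q1a; apply: contraNneq Q1a => da.
  have : spec_x a Q1 * spec_x a G = 0 by rewrite -rmorphM -dA rmorphM spec_xC da mul0r.
  by move/eqP; rewrite mulf_eq0 (negPf (monic_spec_x_neq0 a Gm)) orbF.
apply: (mulfI da); rewrite mulr0 -(eval_xyC a w) -rmorphM dA rmorphM Gw mulr0 //.
Qed.

(* A divisor of G of minimal degree through (a, w) is irreducible. *)
Lemma irreducible_through (a w : F) (G : {poly Fx}) : G != 0 -> through a w G ->
  exists g, [/\ g %| G, exists gI : monic_irreducible_poly g, True & through a w g].
Proof.
move=> G0 Gw.
pose P n := `[< exists H : {poly Fx}, [/\ size H = n, H %| G & through a w H] >].
have exP : exists n, P n by exists (size G); apply/asboolP; exists G.
case: (ex_minnP exP) => n /asboolP [H [sH HG Hw]] minP.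
have H0 : H != 0 by apply: contraNneq G0 => H0; move: HG; rewrite H0 dvd0p.
have HI : irreducible_poly H.
  split=> [|q q1 qH].
    rewrite ltnNge; apply/negP => sH1.
    have /Hw : H %| emb 1.
      by rewrite rmorph1 dvdp1 eqn_leq sH1 lt0n size_poly_eq0 H0.
    by rewrite rmorph1 => /eqP; rewrite oner_eq0.
  have /dvdpP [r HE] := qH.
  have [r0 q0] : r != 0 /\ q != 0 by apply/andP; rewrite -negb_or -mulf_eq0 -HE.
  rewrite -dvdp_size_eqp //; apply/eqP; apply: contrapT => sqH.
  (* By minimality, proper factors q and r of H = r q divide some A and B not vanishing at (a, w).
     But H divides B A, which must vanish there. *)
  have smaller s : s %| H -> (size s < n)%N ->
      exists2 A, s %| emb A & eval_xy a w A != 0.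
    move=> sdvd ltsn; apply: contrapT => nA; move: ltsn; rewrite ltnNge => /negP; apply.
    apply: minP; apply/asboolP; exists s; split=> //; first exact: dvdp_trans HG.
    by move=> A sA; apply/eqP; apply: contrapT => /negP A0; apply: nA; exists A.
  have [||A qA A0] := smaller q => //.
    by rewrite -sH ltn_neqAle dvdp_leq // andbT; apply/eqP.
  have [||B rB B0] := smaller r.
  - by rewrite HE dvdp_mulr.
  - rewrite -sH HE size_mul // -ltnS prednK ?addn_gt0 ?size_poly_gt0 ?r0 //.
    rewrite -[X in (X < _)%N]addn1 ltn_add2l ltn_neqAle eq_sym q1 size_poly_gt0 //.
  have := Hw (B * A); rewrite HE rmorphM dvdp_mul // => /(_ isT)/eqP.
  by rewrite rmorphM mulf_eq0 (negPf A0) (negPf B0).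
have lH : (lead_coef H)^-1 != 0 by rewrite invr_eq0 lead_coef_eq0.
exists ((lead_coef H)^-1 *: H); split.
- by rewrite dvdpZl.
- by exists (irreducible_monicZ HI).
- by move=> A; rewrite dvdpZl //; apply: Hw.
Qed.

(* Two components through (a, w) would make w a double root of G(a, y). *)
Lemma irreducible_through_uniq (a w : F) (G : {poly {poly F}}) (g h : {poly Fx}) :
  G \is monic -> (spec_x a G)^`().[w] != 0 ->
  monic_irreducible_poly g -> monic_irreducible_poly h ->
  g %| emb G -> h %| emb G -> through a w g -> through a w h -> g = h.
Proof.
move=> Gm G'w gI hI gG hG gw hw; apply: contrapT => ngh.
have cop : coprimep g h.
  rewrite irreducible_poly_coprime; last exact: gI.1.
  by apply/negP => /(monic_irreducible_eqp gI hI).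
have /dvdpP [Q GE] : g * h %| emb G by rewrite Gauss_dvdp // gG hG.
have Qm : Q \is monic.
  have : emb G \is monic by apply: monic_map.
  by rewrite GE monicMr // monicMl ?gI.2 ?hI.2.
have [d1 [g1 [g1E g1a]]] := monic_denominator a gI.2.
have [d2 [h1 [h1E h1a]]] := monic_denominator a hI.2.
have [d3 [Q1 [Q1E Q1a]]] := monic_denominator a Qm.
have prodE : (d1 * d2 * d3)%:P * G = g1 * h1 * Q1.
  apply: (map_inj_poly tofrac_inj (rmorph0 _)).
  transitivity (tofrac (d1 * d2 * d3) *: emb G).
    by rewrite rmorphM /= map_polyC mul_polyC.
  by rewrite GE !rmorphM /= -g1E -h1E -Q1E scale_mul3.
move: (congr1 (spec_x a) prodE); rewrite !(rmorphM (spec_x a)) spec_xC => specE.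
(* The three specializations on the right are nonzero in the domain F[y]. Differentiating at w then
   gives the contradiction: g1 and h1 both vanish at w, so the right side has derivative 0, unlike
   G(a, y). *)
have d0 : (d1 * d2 * d3).[a] != 0.
  apply/eqP => d0; move: specE; rewrite d0 mul0r => /esym/eqP.
  by rewrite !mulf_eq0 (negPf g1a) (negPf h1a) (negPf Q1a).
have g1w : (spec_x a g1).[w] = 0 by apply: gw; rewrite -g1E -mul_polyC dvdp_mull.
have h1w : (spec_x a h1).[w] = 0 by apply: hw; rewrite -h1E -mul_polyC dvdp_mull.
move: (d1 * d2 * d3).[a] d0 specE => d d0 specE.
move: (congr1 (fun p => p^`().[w]) specE); rewrite !derivM derivC !hornerE.
rewrite g1w h1w !(mul0r, mulr0, addr0, add0r) => /eqP.
by rewrite mulf_eq0 (negPf d0) (negPf G'w).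
Qed.

End PlaneCurve.

(** * Places of the function field of a component *)

Lemma bezout_scale (R : comNzRingType) (g p u v : {poly R}) (c : R) :
  u * g + v * p = 1 -> p * (c *: v) - c%:P = - (c *: (u * g)).
Proof.
move=> uv; rewrite -[c%:P]mulr1 -!mul_polyC -uv; ring.
Qed.

Section FunctionField.
Variable F : fieldType.
Local Notation Fx := {fraction {poly F}}.
Local Notation tofrac := (@FracField.tofrac {poly F}).
Local Notation emb := (map_poly tofrac).
Variables (g : {poly Fx}) (gI : monic_irreducible_poly g).
Local Notation L := {poly %/ g with gI}.

Definition eval_qpoly : {rmorphism {poly {poly F}} -> L} :=
  ([the {rmorphism {poly Fx} -> {poly %/ g}} of in_qpoly g] :
    {rmorphism {poly Fx} -> L}) \o emb.

Lemma in_qpoly_eq0 (p : {poly Fx}) : (in_qpoly g p = 0 :> {poly %/ g}) <-> g %| p.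
Proof.
split=> [/(congr1 val) /= /eqP|gp].
  by rewrite -Pdiv.IdomainMonic.modpE mk_monicE //; exact: gI.2.
by apply: val_inj => /=; rewrite -Pdiv.IdomainMonic.modpE mk_monicE ?gI.2 //; apply/eqP.
Qed.

Lemma eval_qpoly_eq0 A : eval_qpoly A = 0 <-> g %| emb A.
Proof. exact: in_qpoly_eq0. Qed.

Lemma in_qpolyC (z : Fx) : in_qpoly g z%:P = qpolyC g z.
Proof.
apply: val_inj; rewrite /= Pdiv.CommonRing.rmodp_small //.
by rewrite (leq_ltn_trans (size_polyC_leq1 _)) // size_mk_monic_gt1.
Qed.

Lemma eval_qpolyC (p : {poly F}) : eval_qpoly p%:P = qfpoly_morph gI (tofrac p).
Proof. by rewrite /eval_qpoly /= map_polyC in_qpolyC. Qed.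

Lemma eval_qpoly_frac (z : L) : exists A (d : {poly F}),
  eval_qpoly d%:P != 0 /\ z = eval_qpoly A / eval_qpoly d%:P.
Proof.
have [d [A [d0 dA]]] := common_denominator (z : {poly_(size (mk_monic g)).-1 Fx}).
have ed0 : eval_qpoly d%:P != 0.
  by rewrite eval_qpolyC fmorph_eq0 tofrac_eq0.
exists A, d; split=> //; apply: (mulIf ed0); rewrite divfK //.
rewrite /eval_qpoly /= -dA map_polyC -mul_polyC rmorphM /= mulrC; congr (_ * _).
by apply/esym/val_inj/in_qpoly_small/size_mk_monic.
Qed.

(** A is coprime to the irreducible g. Clearing denominators in a Bezout relation gives A a multiple
    that is a nonzero polynomial in x alone, as a norm would. *)
Lemma eval_qpoly_bezout A : eval_qpoly A != 0 ->
  exists U (d : {poly F}), d != 0 /\ eval_qpoly (A * U) = eval_qpoly d%:P.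
Proof.
move=> A0; have : coprimep g (emb A).
  rewrite irreducible_poly_coprime; last exact: gI.1.
  by apply/negP => /eval_qpoly_eq0 e0; rewrite e0 eqxx in A0.
move=> /Bezout_eq1_coprimepP [[u v] /= uv].
have [d [U [d0 dU]]] := common_denominator v.
exists U, d; split=> //; suff : eval_qpoly (A * U - d%:P) = 0.
  by rewrite rmorphB => /eqP; rewrite subr_eq0 => /eqP.
apply/eval_qpoly_eq0.
rewrite rmorphB rmorphM /= -dU map_polyC (bezout_scale _ uv).
by rewrite dvdpNr -mul_polyC mulrA dvdp_mull.
Qed.

Variables (N : nat) (f : {poly F}) (a w : F).
Local Notation G := ('X^N - f%:P : {poly {poly F}}).
Local Notation c := (const_fun_morph gI).
Hypothesis gG : g %| emb G.

Lemma eval_qpoly_curve : eval_qpoly 'X ^+ N = eval_qpoly f%:P.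
Proof.
have /eval_qpoly_eq0/eqP := gG.
by rewrite rmorphB rmorphXn subr_eq0 => /eqP.
Qed.

Lemma residue_eval_qpolyC (O : set L) (p : {poly F}) : valuation_ring c O ->
  max_ideal O (qfpoly_morph gI (x_param (Some a))) ->
  residue c O (eval_qpoly p%:P) p.[a].
Proof.
move=> OV Oa; rewrite eval_qpolyC.
exact: (@residue_tofrac _ _ (qfpoly_morph gI) O a p OV Oa).
Qed.

Lemma residue_eval_qpoly (O : set L) : valuation_ring c O ->
  max_ideal O (qfpoly_morph gI (x_param (Some a))) ->
  residue c O (eval_qpoly 'X) w ->
  forall A, residue c O (eval_qpoly A) (eval_xy a w A).
Proof.
move=> OV Oa Ow; elim/poly_ind => [|A p IH].
  by rewrite !rmorph0 residue0; apply: (max_ideal0 OV).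
rewrite rmorphD [in X in residue _ _ _ X]rmorphD !rmorphM eval_xyX eval_xyC.
exact: (residueD OV (residueM OV IH Ow) (residue_eval_qpolyC p OV Oa)).
Qed.

(** y is integral over F[x]: at a pole of y, the product of y^N = f(x) and y^(-N) would have residue
    f(a) 0 = 0, but it is 1. *)
Lemma residue_y_exists (O : set L) : (0 < N)%N -> rational_place c O ->
  max_ideal O (qfpoly_morph gI (x_param (Some a))) ->
  exists2 b, residue c O (eval_qpoly 'X) b & b ^+ N = f.[a].
Proof.
move=> N0 [OV Or] Oa.
have fa : residue c O (eval_qpoly 'X ^+ N) f.[a].
  by rewrite eval_qpoly_curve; apply: residue_eval_qpolyC.
have Oy : O (eval_qpoly 'X).
  apply: contrapT => nOy.
  have my : residue c O (eval_qpoly 'X)^-1 0.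
    by rewrite residue0 (max_idealE OV) invrK; right.
  have y0 : eval_qpoly 'X != 0 by apply: contra_not_neq nOy => ->; apply: (vring0 OV).
  have := residueM OV fa (residueX OV N my).
  rewrite -exprMn mulfV // expr1n expr0n eqn0Ngt N0 mulr0 residue0.
  exact: (max_ideal1 OV).
have [b yb] := Or _ Oy; exists b => //.
exact: (residue_uniq OV (residueX OV N yb) fa).
Qed.

Hypotheses (wN : w ^+ N = f.[a]) (dw : N%:R * w ^+ N.-1 != 0) (gw : through a w g).

(* Write y^N - w^N = (y - w) h, with h(w) = N w^(N-1) <> 0: on the curve, the left *)
(* hand side is f(x) - f(a), so x - a generates the maximal ideal at (a, w).       *)
Lemma eval_xy_principal A : eval_xy a w A = 0 ->
  exists h A', eval_xy a w h != 0 /\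
    eval_qpoly (h * A) = eval_qpoly (('X - a%:P)%:P * A').
Proof.
move=> A0; set W : {poly {poly F}} := w%:P%:P;
set t : {poly {poly F}} := ('X - a%:P)%:P.
(* A is A1 (y - w) plus A(x, w), and A(x, w) = A2 (x - a). Multiplying by h turns y - w into s (x -
   a) on the curve. *)
have [A1 A1E] : exists A1, A - (A.[w%:P])%:P = A1 * ('X - W).
  by apply/factor_theorem/rootP; rewrite !hornerE subrr.
have [A2 A2E] : exists A2, A.[w%:P] = A2 * ('X - a%:P).
  by apply/factor_theorem/rootP; rewrite -eval_xyE.
have [s sE] : exists s, f - (f.[a])%:P = s * ('X - a%:P).
  by apply/factor_theorem/rootP; rewrite !hornerE subrr.
set h : {poly {poly F}} := \sum_(l < N) 'X ^+ (N.-1 - l) * W ^+ l.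
have hE : eval_qpoly (('X - W) * h) = eval_qpoly (s%:P * t).
  rewrite -subrXX rmorphB rmorphXn eval_qpoly_curve -rmorphB /t -polyCM -sE.
  by rewrite polyCB /W -!polyC_exp wN.
exists h, (A1 * s%:P + h * A2%:P); split.
  rewrite /h rmorph_sum (eq_bigr (fun=> w ^+ N.-1)) => [|l _].
    by rewrite sumr_const card_ord -mulr_natl.
  rewrite rmorphM !rmorphXn eval_xyX eval_xyC hornerC -exprD subnK //.
  by rewrite -ltnS (ltn_predK (ltn_ord l)).
rewrite -[A](subrK (A.[w%:P])%:P) A1E A2E polyCM.
have split_l (R : comNzRingType) (x1 x2 x3 x4 x5 : R) :
  x1 * (x2 * x3 + x4 * x5) = x2 * (x3 * x1) + x5 * (x1 * x4) by ring.
have split_r (R : comNzRingType) (x1 x2 x3 x4 : R) :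
  x1 * (x2 * x3 + x4) = x2 * (x3 * x1) + x1 * x4 by ring.
by rewrite split_l split_r !(rmorphD eval_qpoly) !(rmorphM eval_qpoly A1) hE.
Qed.

(** The multiple of A lying in F[x] is (x - a)^n q(x) with q(a) <> 0. *)
Lemma eval_qpoly_order A : eval_qpoly A != 0 ->
  exists U n V, eval_xy a w V != 0 /\
    eval_qpoly (A * U) = eval_qpoly (('X - a%:P)%:P ^+ n * V).
Proof.
move=> /eval_qpoly_bezout [U [d [d0 AU]]].
have [n [q qa dE]] := multiplicity_XsubC d a.
exists U, n, (q : {poly F})%:P; split;
  first by move: qa; rewrite d0 /root -(eval_xyC a w).
by rewrite AU dE mulrC polyCM polyC_exp.
Qed.

Definition local_ring_at : set L := local_ring eval_qpoly (eval_xy a w).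

Let const (b : F) : {poly {poly F}} := b%:P%:P.

Let eval_const b : eval_qpoly (const b) = c b.
Proof. by rewrite eval_qpolyC. Qed.

Let xy_const b : eval_xy a w (const b) = b.
Proof. by rewrite eval_xyC hornerC. Qed.

Let xy_ker A : eval_qpoly A = 0 -> eval_xy a w A = 0.
Proof. by move=> /eval_qpoly_eq0; apply: gw. Qed.

Lemma local_ring_at_rational : rational_place c local_ring_at.
Proof.
apply: (@local_ring_rational _ _ c _ eval_qpoly (eval_xy a w)
  const ('X - a%:P)%:P) => //.
- by move=> z; have [A [d ?]] := eval_qpoly_frac z; exists A, d%:P.
- by rewrite eval_qpolyC fmorph_eq0 tofrac_eq0 polyXsubC_eq0.
- by rewrite eval_xyC !hornerE subrr.
- exact: eval_xy_principal.
- exact: eval_qpoly_order.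
Qed.

Lemma residue_local_ring_at A : residue c local_ring_at (eval_qpoly A) (eval_xy a w A).
Proof.
have := @residue_local_ring _ _ c _ eval_qpoly (eval_xy a w)
  const eval_const xy_const xy_ker A 1.
by rewrite !rmorph1 !divr1; apply; rewrite oner_neq0.
Qed.

(** The residues of x and y determine those of all of F[x, y], so O contains the local ring at (a,
    w), and rational places are never properly nested. *)
Lemma local_ring_at_uniq (O : set L) : rational_place c O ->
  max_ideal O (qfpoly_morph gI (x_param (Some a))) ->
  residue c O (eval_qpoly 'X) w -> O = local_ring_at.
Proof.
move=> OR Oa Ow; apply/esym/(rational_place_sub local_ring_at_rational OR).
apply: (local_ring_sub OR.1); exact: residue_eval_qpoly OR.1 Oa Ow.
Qed.

End FunctionField.

(** * Rational points of the model *)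

(** The relation r is the graph of a bijection from A to P. A relation suits values of y, whose
    definition depends on the function field of the point. *)
Lemma ncard_card (T : Type) (I : finType) (A : set T) (P : pred I)
    (r : T -> I -> Prop) :
  finite_set A ->
  (forall Q, A Q -> exists2 w, P w & r Q w) ->
  (forall w, P w -> exists2 Q, A Q & r Q w) ->
  (forall Q Q' w, A Q -> A Q' -> r Q w -> r Q' w -> Q = Q') ->
  (forall Q w w', A Q -> r Q w -> r Q w' -> w = w') ->
  ncard A = #|P|.
Proof.
move=> Afin rA rP rinj rfun.
(* [option I] supplies a value outside A even when I is empty. *)
have [|rho rhoP] := @choice {classic T} (option I) (fun Q ow =>
    A Q -> exists w, [/\ ow = Some w, P w & r Q w]).
  move=> Q; have [AQ|nAQ] := pselect (A Q); last by exists None.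
  by have [w Pw rQ] := rA Q AQ; exists (Some w) => _; exists w.
have AE (Q : {classic T}) : (Q \in fset_set (A : set {classic T})) = (`[< A Q >]).
  rewrite in_fset_set //; apply/idP/asboolP; rewrite inE //.
rewrite /ncard cardE -(size_map (@Some I)) -[LHS](size_map rho).
apply/perm_size/uniq_perm.

- rewrite map_inj_in_uniq ?fset_uniq // => Q Q';
  rewrite !AE => /asboolP AQ /asboolP AQ' rhoQ.
  have [w [e _ rQ]] := rhoP Q AQ; have [w' [e' _ rQ']] := rhoP Q' AQ'.
  by move: rhoQ; rewrite e e' => -[ww']; apply: rinj rQ _ => //; rewrite ww'.
- by rewrite map_inj_uniq ?enum_uniq // => x y [].
move=> ow; apply/mapP/mapP => [[Q]|[w]].
  rewrite AE => /asboolP AQ ->; have [w [-> Pw _]] := rhoP Q AQ.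
  by exists w; rewrite ?mem_enum.
rewrite mem_enum => Pw ->; have [Q AQ rQ] := rP w Pw.
exists Q; first by rewrite AE; apply/asboolP.
by have [w' [-> _ rQ']] := rhoP Q AQ; rewrite (rfun Q w w').
Qed.

Lemma ncard0 (T : Type) : ncard (set0 : set T) = 0%N.
Proof. by rewrite /ncard fset_set0 cardfs0. Qed.

Lemma ncardU (T : Type) (A B : set T) : finite_set A -> finite_set B ->
  A `&` B = set0 -> ncard (A `|` B) = (ncard A + ncard B)%N.
Proof.
move=> Af Bf AB; rewrite /ncard fset_setU // cardfsU -fset_setI //.
by rewrite AB fset_set0 cardfs0 subn0.
Qed.

Lemma ncard_bigcup (T : Type) (I : finType) (A : I -> set T) :
  (forall i, finite_set (A i)) -> (forall i j x, A i x -> A j x -> i = j) ->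
  finite_set (\bigcup_i A i) /\ ncard (\bigcup_i A i) = (\sum_i ncard (A i))%N.
Proof.
move=> Af Adisj.
have -> : \bigcup_i A i = \bigcup_(i in [set` enum I]) A i.
  by apply: eq_bigcupl; split=> i //= _; rewrite mem_enum.
rewrite -big_enum /=; have := enum_uniq I.
elim: (enum I) => [_|i s IH /= /andP[nis us]].
  by rewrite set_nil bigcup_set0 big_nil ncard0; split=> //; apply: finite_set0.
have [sf sc] := IH us.
have -> : \bigcup_(l in [set` i :: s]) A l = A i `|` \bigcup_(l in [set` s]) A l.
  apply/seteqP; split=> x.
    by move=> [l /=]; rewrite inE => /orP[/eqP ->|ls] Alx; [left|right; exists l].
  move=> [Aix|[l /= ls Alx]]; first by exists i => //=; rewrite inE eqxx.
  by exists l => //=; rewrite inE ls orbT.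
rewrite big_cons; split; first by rewrite finite_setU.
rewrite ncardU // ?sc //; apply/seteqP; split=> // x [Aix [j /= js Ajx]].
by move: nis; rewrite (Adisj _ _ _ Aix Ajx) js.
Qed.

Section Points.
Variables (F : finFieldType) (N i j k : nat) (lam : F).
Local Notation Fx := {fraction {poly F}}.
Local Notation tofrac := (@FracField.tofrac {poly F}).
Local Notation emb := (map_poly tofrac).
Local Notation X := (rational_points N i j k lam).
Local Notation XP := (rational_points_above N i j k lam).
Hypothesis N_gt0 : (0 < N)%N.

Definition curve_rhs : {poly F} := 'X^i * (1 - 'X) ^+ j * (1 - lam *: 'X) ^+ k.

Lemma curve_polyE : curve_poly N i j k lam = emb ('X^N - curve_rhs%:P).
Proof. by rewrite rmorphB rmorphXn /= map_polyX map_polyC. Qed.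

Lemma rational_points_aboveP (Q : Defs.point F) (P : option F) : XP P Q <->
  Defs.comp Q %| curve_poly N i j k lam /\
  exists gI : monic_irreducible_poly (Defs.comp Q),
    @rational_place F {poly %/ Defs.comp Q with gI} (const_fun_morph gI) (ring_at Q) /\
    @max_ideal {poly %/ Defs.comp Q with gI} (ring_at Q) (qfpoly_morph gI (x_param P)).
Proof.
split=> [[[gG [gI OR]] [gI' OP]]|[gG [gI [OR OP]]]].
  by split=> //; exists gI; split.
by split; [split=> //|]; exists gI.
Qed.

(** At a rational place, x either is regular, with some residue a in F, or has a pole, so that 1/x
    vanishes. *)
Lemma rational_points_cover : X = \bigcup_P XP P.
Proof.
apply/seteqP; split=> [Q QX|Q [P _ []] //].
have [gG [gI OR]] := QX.
have [OV Or] : @rational_place F {poly %/ Defs.comp Q with gI}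
    (const_fun_morph gI) (ring_at Q) by [].
have [Ox|nOx] := pselect (ring_at Q (qfpoly_morph gI (tofrac 'X))).
  have [a ha] := Or _ Ox; exists (Some a) => //.
  apply/rational_points_aboveP; split=> //; exists gI; split=> //.
  by rewrite /x_param rmorphB rmorphB.
exists None => //; apply/rational_points_aboveP; split=> //; exists gI; split=> //.
by rewrite (max_idealE OV) /x_param fmorphV invrK; right.
Qed.

Lemma rational_points_disjoint P P' Q : XP P Q -> XP P' Q -> P = P'.
Proof.
move=> /rational_points_aboveP [gG [gI [[OV _] OP]]].
move=> /rational_points_aboveP [_ [gI' [_ OP']]].
rewrite (monic_irreducible_irrelevance gI' gI) in OP'.
pose O : set {poly %/ Defs.comp Q with gI} := ring_at Q.
have fin b : max_ideal O (qfpoly_morph gI (x_param (Some b))) ->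
    residue (const_fun_morph gI) O (qfpoly_morph gI (tofrac 'X)) b.
  by rewrite /x_param rmorphB rmorphB.
have inf b : max_ideal O (qfpoly_morph gI (x_param (Some b))) ->
    ~ max_ideal O (qfpoly_morph gI (x_param None)).
  move=> /fin /(residue_val OV) Ox; rewrite (max_idealE OV) fmorphV invrK => -[|//].
  by apply/eqP; rewrite invr_eq0 fmorph_eq0 tofrac_eq0 polyX_eq0.
case: P P' OP OP' => [b|] [b'|] //.
- by move=> /fin h /fin h'; rewrite (residue_uniq OV h h').
- by move=> /inf.
- by move=> + /inf.
Qed.

Lemma ncard_rational_points :
  finite_set X /\ ncard X = (\sum_P ncard (XP P))%N.
Proof.
rewrite rational_points_cover; apply: ncard_bigcup.
  by move=> P; apply: finite_rational_points_above.
by move=> P P' Q; apply: rational_points_disjoint.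
Qed.

Definition has_y_value (Q : Defs.point F) (w : F) :=
  exists gI : monic_irreducible_poly (Defs.comp Q),
    @residue F {poly %/ Defs.comp Q with gI}
      (const_fun_morph gI) (ring_at Q) (eval_qpoly gI 'X) w.

(** The bijection sends a place to the value of y. Since N and f(a) are nonzero in F, every root of
    w^N = f(a) is simple. *)
Lemma ncard_unramified (a : F) : N%:R != 0 :> F -> curve_rhs.[a] != 0 ->
  ncard (XP (Some a)) = #|[pred w : F | w ^+ N == curve_rhs.[a]]|.
Proof.
move=> N0 fa0; set G : {poly {poly F}} := 'X^N - curve_rhs%:P.
have Gm : G \is monic by rewrite monicXnsubC.
have eval_G w : eval_xy a w G = w ^+ N - curve_rhs.[a].
  by rewrite rmorphB rmorphXn eval_xyX eval_xyC.
have dw w : w ^+ N = curve_rhs.[a] -> N%:R * w ^+ N.-1 != 0.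
  move=> wN; rewrite mulf_neq0 // expf_neq0 //.
  by apply: contraNneq fa0 => w0; rewrite -wN w0 expr0n eqn0Ngt N_gt0.
have dG w : (spec_x a G)^`().[w] = N%:R * w ^+ N.-1.
  rewrite rmorphB rmorphXn spec_xC /spec_x /= map_polyX derivB derivC subr0 derivXn.
  by rewrite hornerMn hornerXn mulr_natl.
have thr (Q : Defs.point F) w : XP (Some a) Q -> has_y_value Q w ->
    through a w (Defs.comp Q).
  move=> /rational_points_aboveP [gG [gI [[OV Or] OP]]] [gI'].
  rewrite (monic_irreducible_irrelevance gI' gI) => Ow A /(eval_qpoly_eq0 gI) A0.
  apply: (residue_uniq OV (residue_eval_qpoly OV OP Ow A)).
  by rewrite A0 residue0; apply: (max_ideal0 OV).
apply: (@ncard_card _ _ _ _ has_y_value).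
- exact: finite_rational_points_above.
- move=> Q /rational_points_aboveP [gG [gI [OR OP]]].
  rewrite curve_polyE in gG.
  have [b yb bN] := residue_y_exists gG N_gt0 OR OP.
  by exists b; [apply/eqP|exists gI].
- move=> w /eqP wN.
  have Gw : through a w (emb G) by apply: through_monic => //; rewrite eval_G wN subrr.
  have [|g [gG [gI _] gw]] := irreducible_through _ Gw.
    exact/monic_neq0/monic_map.
  exists (@Point F g (@local_ring_at F g gI a w)); last first.
    by exists gI; have := residue_local_ring_at gI gw 'X; rewrite eval_xyX.
  apply/rational_points_aboveP; split; first by rewrite curve_polyE.
  exists gI; split; first exact: local_ring_at_rational gG wN (dw w wN) gw.
  have := residue_local_ring_at gI gw ('X - a%:P)%:P.
  by rewrite eval_xyC !hornerE subrr residue0 eval_qpolyC.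
- move=> Q Q' w QX QX' Qw Qw'.
  have wN : w ^+ N = curve_rhs.[a].
    apply/eqP; rewrite -subr_eq0 -eval_G; apply/eqP; apply: (thr Q w QX Qw).
    by rewrite -curve_polyE; have [] := (rational_points_aboveP Q (Some a)).1 QX.
  have gw := thr Q w QX Qw; have gw' := thr Q' w QX' Qw'.
  move: QX QX' => /rational_points_aboveP [gG [gI [OR OP]]].
  move=> /rational_points_aboveP [gG' [gI' [OR' OP']]].
  rewrite curve_polyE in gG gG'.
  case: Qw => gI1; rewrite (monic_irreducible_irrelevance gI1 gI) => Qw {gI1}.
  case: Qw' => gI1; rewrite (monic_irreducible_irrelevance gI1 gI') => Qw' {gI1}.
  have gg' : Defs.comp Q = Defs.comp Q'.
    by apply: (irreducible_through_uniq Gm _ gI gI' gG gG' gw gw'); rewrite dG dw.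
  (* Only after the components are identified do the two rings live in the same field, where both
     equal the local ring at (a, w). *)
  case: Q Q' gg' gI gI' gG gG' OR OR' OP OP' Qw Qw' gw gw' => [g O] [g' O'] /= gg'.
  subst g' => gI gI'; rewrite (monic_irreducible_irrelevance gI' gI) {gI'}.
  move=> gG _ OR OR' OP OP' Qw Qw' gw _; congr Point.
  rewrite (local_ring_at_uniq gG wN (dw w wN) gw OR OP Qw).
  by rewrite (local_ring_at_uniq gG wN (dw w wN) gw OR' OP' Qw').
- move=> Q w w' /rational_points_aboveP [gG [gI [[OV _] _]]] [gI1 Qw] [gI2 Qw'].
  rewrite (monic_irreducible_irrelevance gI1 gI) in Qw.
  rewrite (monic_irreducible_irrelevance gI2 gI) in Qw'.
  exact: (@residue_uniq F {poly %/ Defs.comp Q with gI} (const_fun_morph gI)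
    _ OV _ _ _ Qw Qw').
Qed.

End Points.

(** * Sums of characters *)

Section CharacterSum.
Variable F : finFieldType.
Local Notation U := [set: {unit F}]%G.

Lemma finField_card_natr : (#|F|%:R : F) = 0.
Proof.
by rewrite -FinRing.zmodXgE -cardsT; apply/eqP; rewrite -order_dvdn order_dvdG ?inE. Qed.

(** In F, 0 = q = M N + 1, so N = 0 would give 1 = 0. *)
Lemma finField_natr_neq0 (N : nat) : (N %| #|F|.-1)%N -> (N%:R : F) != 0.
Proof.
move=> /dvdnP [M qE]; have := finField_card_natr.
have -> : #|F| = (M * N).+1 by rewrite -qE prednK // (ltnW (finNzRing_gt1 F)).
rewrite -addn1 natrD natrM => h; apply/eqP => N0; move: h.
by rewrite N0 mulr0 add0r => /eqP; rewrite oner_eq0.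
Qed.

Lemma unit_of_neq0 (x : F) : x != 0 -> exists u : {unit F}, val u = x.
Proof. by rewrite -unitfE => Ux; exists (FinRing.unit F Ux). Qed.

(** A root z^r satisfies r N = e modulo q - 1, a multiple of N, so N divides e. Conversely, with e =
    e' N and q - 1 = M N, the elements z^(e' + l M) for l < N are N distinct roots, and a polynomial
    of degree N has no more. *)
Lemma card_roots_of_unit (z : {unit F}) (N e : nat) :
  [set: {unit F}]%SET = <[z]>%g -> (0 < N)%N -> (N %| #|F|.-1)%N ->
  #|[pred w : F | w ^+ N == val (z ^+ e)%g]| = (if (N %| e)%N then N else 0)%N.
Proof.
move=> Uz N0 Nq.
have oz : #[z]%g = #|F|.-1 by rewrite -card_finField_unit Uz.
have zP (w : F) : w ^+ N = val (z ^+ e)%g ->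
    exists2 r, w = val (z ^+ r)%g & (r * N = e %[mod #[z]%g])%N.
  move=> wN; have w0 : w != 0.
    apply: contra_eqN wN => /eqP ->; rewrite expr0n eqn0Ngt N0 /= eq_sym.
    by have := valP (z ^+ e)%g; rewrite unitfE.
  have [u uw] := unit_of_neq0 w0; have : u \in <[z]>%g by rewrite -Uz inE.
  move=> /cycleP [r ur]; exists r; first by rewrite -uw ur.
  apply/eqP; rewrite -eq_expg_mod_order; apply/eqP/val_inj.
  by rewrite expgM -ur FinRing.val_unitX uw.
case: ifP => [Ne|nNe]; last first.
  apply: eq_card0 => w; rewrite !inE; apply/negP => /eqP/zP [r _ re].
  by move: nNe; rewrite /dvdn -(modn_dvdm e (m := #[z]%g))
    -?re ?modn_dvdm ?modnMl ?eqxx // oz.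
apply/eqP; rewrite eqn_leq; apply/andP; split.
  rewrite cardE -ltnS -(size_XnsubC (val (z ^+ e)%g) N0).
  apply: max_poly_roots; rewrite ?enum_uniq //.
    by rewrite monic_neq0 // monicXnsubC.
  by apply/allP => w; rewrite mem_enum inE => wN; rewrite /root !hornerE subr_eq0.
have [e' eE] := dvdnP Ne; have [M qE] := dvdnP Nq.
have M0 : (0 < M)%N.
  rewrite lt0n; apply/eqP => M0; have := finNzRing_gt1 F.
  by rewrite ltnNge -subn_eq0 subn1 qE M0.
pose h (l : 'I_N) : F := val (z ^+ (e' + l * M))%g.
have h_inj : injective h.
  move=> l l' /val_inj/eqP; rewrite eq_expg_mod_order oz qE eqn_modDl => /eqP.
  rewrite !modn_small 1?mulnC ?ltn_pmul2l // => /eqP.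
  by rewrite ![(_ * M)%N]mulnC eqn_pmul2l // => /eqP/val_inj.
rewrite -{1}(card_ord N) -(card_codom h_inj) subset_leq_card //.
apply/fintype.subsetP => _ /codomP [l ->]; rewrite inE -FinRing.val_unitX -expgM.
apply/eqP; congr val; apply/eqP; rewrite eq_expg_mod_order oz qE mulnDl eE.
by rewrite addnC -mulnA modnMDl.
Qed.

Variables (xi : 'CF(U)) (N : nat).
Hypotheses (xi_lin : xi \is a linear_char) (xi_ord : #[xi]%CF = N).
Hypotheses (N0 : (0 < N)%N) (Nq : (N %| #|F|.-1)%N).

(** As xi has exact order N, xi(z) is a primitive N-th root of unity for a generator z. So xi(z^e) =
    1 exactly when N divides e, and otherwise the geometric sum is 0. *)
Lemma card_power_roots (u : {unit F}) :
  #|[pred w : F | w ^+ N == val u]|%:R = \sum_(m < N) xi u ^+ m :> algC.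
Proof.
have /cyclicP [z Uz] := field_unit_group_cyclic U.
have /cycleP [e ->] : u \in <[z]>%g by rewrite -Uz inE.
rewrite (card_roots_of_unit e Uz N0 Nq) lin_charX ?inE //.
have -> : (N %| e)%N = (xi z ^+ e == 1).
  rewrite -xi_ord; apply/dvdn_cforderP/eqP => [->|ze1 x]; rewrite ?inE // => _.
  have /cycleP [r ->] : x \in <[z]>%g by rewrite -Uz inE.
  by rewrite lin_charX ?inE // -exprM mulnC exprM ze1 expr1n.
have zN : xi z ^+ N = 1 by apply: (dvdn_cforderP _); rewrite ?xi_ord ?inE.
case: eqP => [->|ze1].
  by rewrite (eq_bigr (fun=> 1)) ?sumr_const ?card_ord // => m _; rewrite expr1n.
apply/esym/(@mulfI _ (xi z ^+ e - 1)); first by rewrite subr_eq0; apply/eqP.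
by rewrite mulr0 -subrX1 -exprM mulnC exprM zN expr1n subrr.
Qed.

Lemma ext_charE (chi : 'CF(U)) (u : {unit F}) : ext_char chi (val u) = chi u.
Proof. by rewrite /ext_char valK. Qed.

Lemma ext_char0 (chi : 'CF(U)) : ext_char chi 0 = 0.
Proof. by rewrite /ext_char insubF // unitr0. Qed.

Lemma linear_char_unit : xi \is a GRing.unit.
Proof.
apply/unitrP; exists (xi ^+ N.-1).
by rewrite -exprSr -exprS prednK // -xi_ord exp_cforder.
Qed.

(** This is the summand of Greene's function, with inner characters xi^(im), xi^(jm), xi^(km).
    Positive exponents make f(x) vanish exactly when one of the extended characters is taken at
    0. *)
Lemma ext_char_curve (i j k : nat) (lam x : F) (m : nat) :
  (0 < i)%N -> (0 < j)%N -> (0 < k)%N ->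
  ext_char (xi ^+ (i * m)) x *
    ext_char ((xi ^+ (i * m))^-1 * xi ^+ (m * (i + j))) (1 - x) *
    ext_char (xi ^- (k * m))^-1 (1 - lam * x) =
  if insub (curve_rhs i j k lam).[x] is Some u then xi (u : {unit F}) ^+ m else 0.
Proof.
move=> i0 j0 k0; rewrite invrK.
have -> : (xi ^+ (i * m))^-1 * xi ^+ (m * (i + j)) = xi ^+ (j * m).
  by rewrite mulnDr exprD [(m * i)%N]mulnC mulKr ?unitrX ?linear_char_unit // mulnC.
have fE : (curve_rhs i j k lam).[x] = x ^+ i * (1 - x) ^+ j * (1 - lam * x) ^+ k.
  by rewrite /curve_rhs !hornerE.
case: insubP => [u _ uE|]; last first.
  rewrite unitfE negbK fE !mulf_eq0 !expf_eq0 i0 j0 k0 /= => /orP[/orP[]|] /eqP ->.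
  - by rewrite ext_char0 !mul0r.
  - by rewrite ext_char0 mulr0 mul0r.
  - by rewrite ext_char0 mulr0.
have : val u != 0 by rewrite -unitfE; apply: valP.
rewrite uE fE !mulf_eq0 !negb_or => /andP[/andP[]].
rewrite !expf_eq0 i0 j0 k0 /= => /unit_of_neq0 [a ax]
  /unit_of_neq0 [b bx] /unit_of_neq0 [c cx].
have -> : u = (a ^+ i * b ^+ j * c ^+ k)%g.
  by apply: val_inj; rewrite uE fE /= !FinRing.val_unitX -cx -bx -ax.
rewrite -cx -bx -ax !ext_charE !exp_cfunE ?inE //.
by rewrite !lin_charM ?inE // !lin_charX ?inE // !exprMn !exprM.
Qed.

End CharacterSum.

(** * Summation over the x-line *)

Section PointCount.
Variables (F : finFieldType) (xi : 'CF([set: {unit F}]%G)) (N i j k : nat) (lam : F).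
Hypotheses (xi_lin : xi \is a linear_char) (xi_ord : #[xi]%CF = N).
Hypotheses (N0 : (0 < N)%N) (Nq : (N %| #|F|.-1)%N).
Hypotheses (i0 : (0 < i)%N) (j0 : (0 < j)%N) (k0 : (0 < k)%N).
Hypotheses (lam0 : lam != 0) (lam1 : lam != 1).
Local Notation f := (curve_rhs i j k lam).

(** The zeros of f are 0, 1 and 1/lam, which are distinct because lam is neither 0 nor 1. *)
Lemma sum_split_branch (V : nmodType) (g : F -> V) :
  \sum_x g x = g 0 + (g 1 + (g lam^-1 + \sum_(x | f.[x] != 0) g x)).
Proof.
rewrite (bigD1 0) // (bigD1 1) /= ?oner_neq0 // (bigD1 lam^-1) /=; last first.
  by rewrite invr_eq0 lam0 invr_eq1.
do 3!congr (_ + _); apply: eq_bigl => x.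
rewrite /curve_rhs !hornerE !mulf_eq0 !expf_eq0 i0 j0 k0 /= !negb_or.
congr (_ && _ && _); first by rewrite subr_eq0 eq_sym.
by rewrite subr_eq0 eq_sym -(inj_eq (mulfI lam0)) mulfV.
Qed.

(** The factor q cancels 1/q, and the signs combine to xi(-1)^(2m(i + j)) = 1. *)
Lemma greene2F1_sum (m : nat) :
  #|F|%:R * (ext_char (xi ^+ (m * j)) (-1) *
    greene2F1 (xi ^- (k * m)) (xi ^+ (i * m)) (xi ^+ (m * (i + j))) lam) =
  \sum_(x | f.[x] != 0) (if insub f.[x] is Some u then xi (u : {unit F}) ^+ m else 0).
Proof.
have [l lE] := unit_of_neq0 lam0.
have [n nE] : exists u : {unit F}, val u = - 1.
  by apply: unit_of_neq0; rewrite oppr_eq0 oner_neq0.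
have n2 : xi n ^+ 2 = 1.
  rewrite -lin_charX ?inE //; have -> : (n ^+ 2)%g = 1%g.
    by apply: val_inj; rewrite FinRing.val_unitX nE sqrrN expr1n.
  exact: lin_char1.
have q0 : #|F|%:R != 0 :> algC by rewrite pnatr_eq0 -lt0n (ltnW (finNzRing_gt1 F)).
rewrite /greene2F1; under eq_bigr do rewrite (ext_char_curve xi_lin xi_ord N0) //.
rewrite -lE ext_charE cfun1E inE mul1r -nE !ext_charE -exprD !exp_cfunE ?inE //.
set S := \sum_x _; transitivity (xi n ^+ (m * j + (i * m + m * (i + j))) * S).
  have cancel_q (q A B T : algC) : q != 0 -> q * (A * (B / q * T)) = A * B * T.
    by move=> ?; field.
  by rewrite [in RHS]exprD cancel_q.
rewrite (_ : (m * j + _ = 2 * (m * (i + j)))%N); last by ring.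
rewrite exprM n2 expr1n mul1r big_mkcond [RHS]big_mkcond; apply: eq_bigr => x _.
by rewrite lE; have [->|//] := eqVneq f.[x] 0; rewrite insubF ?unitr0.
Qed.

Lemma power_roots_sum (x : F) : f.[x] != 0 ->
  #|[pred w : F | w ^+ N == f.[x]]|%:R =
  1 + \sum_(1 <= m < N)
    (if insub f.[x] is Some u then xi (u : {unit F}) ^+ m else 0) :> algC.
Proof.
move=> /unit_of_neq0 [u ux]; rewrite -ux (card_power_roots xi_lin xi_ord N0 Nq) valK.
by rewrite -(big_mkord xpredT (fun m => xi u ^+ m)) big_ltn // expr0.
Qed.

Lemma ncard_curve :
  let n P := ncard (rational_points_above N i j k lam P) in
  (ncard (rational_points N i j k lam))%:R =
    1 + #|F|%:R
    + #|F|%:R * (\sum_(1 <= m < N)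
        ext_char (xi ^+ (m * j)) (-1) *
        greene2F1 (xi ^- (k * m)) (xi ^+ (i * m)) (xi ^+ (m * (i + j))) lam)
    + (n (Some 0%R))%:R + (n (Some 1%R))%:R + (n (Some lam^-1))%:R
    + (n None)%:R - 4 :> algC.
Proof.
move=> n; have [_ ->] := ncard_rational_points i j k lam N0.
rewrite (bigD1 None) //= (reindex_onto Some (odflt 0)) /=; last by case.
rewrite (eq_bigl xpredT) => [|x]; last by rewrite eqxx.
rewrite sum_split_branch -/n.
have -> : (\sum_(x | (f.[x] != 0)%R) n (Some x) =
    \sum_(x | (f.[x] != 0)%R) #|[pred w : F | (w ^+ N == f.[x])%R]|)%N.
  by apply: eq_bigr => x fx; apply: ncard_unramified => //; apply: finField_natr_neq0.
(* The trivial character contributes the number q - 3 of unbranched a, which the formula writes as 1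
   + q - 4. *)
have qE : #|F|%:R = 3 + \sum_(x | f.[x] != 0) 1 :> algC.
  transitivity (\sum_(x : F) 1 : algC); first by rewrite sumr_const.
  by rewrite sum_split_branch; ring.
rewrite mulr_sumr (eq_bigr _ (fun m _ => greene2F1_sum m)) exchange_big /=.
rewrite !natrD natr_sum (eq_bigr _ power_roots_sum) big_split /= qE.
have rearrange (a b c d x y : algC) :
  d + (a + (b + (c + (x + y)))) = 1 + (3 + x) + y + a + b + c + d - 4 by ring.
exact: rearrange.
Qed.

End PointCount.

Unset Implicit Arguments.

Theorem theorem11 (p s N i j k : nat) (F : finFieldType)
    (xi : 'CF([set: {unit F}]%G)) (lam : F) :
  prime p -> (3 < p)%N -> #|F| = (p ^ s)%N -> (#|F| = 1 %[mod N])%N ->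
  (1 <= i < N)%N -> (1 <= j < N)%N -> (1 <= k < N)%N ->
  xi \is a linear_char -> #[xi]%CF = N ->
  lam != 0 -> lam != 1 ->
  let X := rational_points N i j k lam in
  let n P := ncard (rational_points_above N i j k lam P) in
  finite_set X /\
  (ncard X)%:R =
    1 + #|F|%:R
    + #|F|%:R * (\sum_(1 <= m < N)
        ext_char (xi ^+ (m * j)) (-1) *
        greene2F1 (xi ^- (k * m)) (xi ^+ (i * m)) (xi ^+ (m * (i + j))) lam)
    + (n (Some 0%R))%:R + (n (Some 1%R))%:R + (n (Some lam^-1))%:R
    + (n None)%:R - 4 :> algC.
Proof.
move=> _ _ _ qN /andP[i0 iN] /andP[j0 _] /andP[k0 _] xi_lin xi_ord lam0 lam1 X n.
have N0 : (0 < N)%N by apply: leq_ltn_trans iN.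
have Nq : (N %| #|F|.-1)%N.
  by rewrite -subn1 -eqn_mod_dvd ?(ltnW (finNzRing_gt1 F)) //; apply/eqP.
split; first by have [] := ncard_rational_points i j k lam N0.
exact: ncard_curve.
Qed.
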